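(* Let $\mathfrak g=\mathring{\mathfrak g}\otimes\mathbb C[t^{\pm}]\oplus\mathbb Cc\oplus\mathbb Cd$ be an untwisted affine Kac-Moody algebra with root system $\Delta$. Then there is a one-to-one correspondence between maximal real closed subroot systems of $\Delta$ and maximal symmetric regular subalgebras of $\mathfrak g$ different from $[\mathfrak g,\mathfrak g]$.
   Context: $\mathring{\mathfrak g}$ is a finite-dimensional complex simple Lie algebra with Cartan subalgebra $\mathring{\mathfrak h}$ and root system $\mathring\Delta$. $\mathfrak g=\mathring{\mathfrak g}\otimes\mathbb C[t^{\pm}]\oplus\mathbb Cc\oplus\mathbb Cd$ is the untwisted affine algebra with $c$ central and $d$ the degree derivation, with Cartan subalgebra $\mathfrak h=\mathring{\mathfrak h}\oplus\mathbb Cc\oplus\mathbb Cd$, root spaces $\mathfrak g_\alpha$, roots $\Delta=\Delta^{\mathrm{re}}\cup\Delta^{\mathrm{im}}$, $\Delta^{\mathrm{re}}=\{\alpha+r\delta:\alpha\in\mathring\Delta,r\in\mathbb Z\}$, $\Delta^{\mathrm{im}}=\{r\delta:r\in\mathbb Z\setminus\{0\}\}$, and reflections $s_\alpha$, $\alpha\in\Delta^{\mathrm{re}}$. A regular subalgebra is an $\mathfrak h$-invariant Lie subalgebra $\mathfrak s\subseteq\mathfrak g$; $\Delta(\mathfrak s)=\{\alpha\in\Delta:\mathfrak g_\alpha\cap\mathfrak s\neq0\}$, and $\mathfrak s$ is symmetric if $\Delta(\mathfrak s)=-\Delta(\mathfrak s)$. A proper symmetric regular subalgebra is called maximal if it is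 not properly contained in any other proper symmetric regular subalgebra of $\mathfrak g$. A real closed subroot system of $\Delta$ is a non-empty subset $\Psi\subseteq\Delta^{\mathrm{re}}$ such that $s_\alpha(\beta)\in\Psi$ for all $\alpha,\beta\in\Psi$, and such that $\alpha,\beta\in\Psi$, $\alpha+\beta\in\Delta^{\mathrm{re}}$ implies $\alpha+\beta\in\Psi$. It is maximal if it is maximal with respect to inclusion among real closed subroot systems properly contained in $\Delta^{\mathrm{re}}$. *)

(* Defs.v *)
From HB Require Import structures.
From mathcomp Require Import all_boot all_order all_algebra.
From mathcomp Require Import finmap complex.
From mathcomp Require Import all_classical all_reals.
From mathcomp Require Import ring.

Set Implicit Arguments.
Unset Strict Implicit.
Unset Printing Implicit Defensive.

Import Order.TTheory GRing.Theory Num.Theory.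

Local Open Scope classical_set_scope.
Local Open Scope ring_scope.

HB.mixin Record isLieAlgebra (F : fieldType) L of GRing.Lmodule F L := {
  lie : L -> L -> L;
  lie_linearl : forall y, linear (lie^~ y);
  lie_linearr : forall x, linear (lie x);
  liexx : forall x, lie x x = 0;
  lie_jacobi : forall x y z,
    lie x (lie y z) + lie y (lie z x) + lie z (lie x y) = 0 }.

#[short(type="lieAlgType")]
HB.structure Definition LieAlgebra (F : fieldType) :=
  {L of GRing.Lmodule F L & isLieAlgebra F L}.

#[short(type="finLieAlgType")]
HB.structure Definition FinLieAlgebra (F : fieldType) :=
  {L of Vector F L & isLieAlgebra F L}.

Section LieTheory.
Variables (F : fieldType) (L : lieAlgType F).
Implicit Types (x y z : L).

HB.instance Definition _ x :=
  GRing.isLinear.Build F L L *:%R (lie x) (@lie_linearr F L x).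

Lemma lie0l y : lie 0 y = 0.
Proof.
have := @lie_linearl F L y (-1) 0 0.
by rewrite scaler0 addr0 scaleN1r addNr.
Qed.

Lemma lieDl x x' y : lie (x + x') y = lie x y + lie x' y.
Proof. by have := @lie_linearl F L y 1 x x'; rewrite !scale1r. Qed.

Lemma lieZl a x y : lie (a *: x) y = a *: lie x y.
Proof. by have := @lie_linearl F L y a x 0; rewrite lie0l !addr0. Qed.

Lemma lieC x y : lie x y = - lie y x.
Proof.
apply/eqP; rewrite -addr_eq0; apply/eqP.
have := @liexx F L (x + y).
by rewrite lieDl !linearD /= !liexx add0r addr0.
Qed.

Definition is_subspace (S : set L) : Prop :=
  S 0 /\ forall a x y, S x -> S y -> S (a *: x + y).

Definition is_lie_subalgebra (S : set L) : Prop :=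
  is_subspace S /\ forall x y, S x -> S y -> S (lie x y).

Definition derived_algebra : set L :=
  smallest is_subspace [set u | exists x y, u = lie x y].

End LieTheory.
Arguments derived_algebra {F} L.

(* Weights, roots and reflections of a Lie algebra L relative to an abelian
   subalgebra, given as a vector space H with its inclusion iota into L. *)
Section Roots.
Variables (F : fieldType) (L : lieAlgType F) (H : vectType F) (iota : H -> L).

Definition weight_space (lambda : 'Hom(H, F^o)) : set L :=
  [set x | forall h, lie (iota h) x = (lambda h : F) *: x].

Definition roots : set 'Hom(H, F^o) :=
  [set lambda | lambda != 0 /\ exists2 x, weight_space lambda x & x != 0].

(* The coroot of a real root alpha is the unique h in [L_alpha, L_(- alpha)]
   with alpha h = 2. As L_alpha and L_(- alpha) are lines, every element of
   [L_alpha, L_(- alpha)] is a single bracket. *)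
Definition is_coroot (alpha : 'Hom(H, F^o)) (h : H) : Prop :=
  alpha h = 2%:R /\
  exists x y, [/\ weight_space alpha x, weight_space (- alpha) y
                & iota h = lie x y].

Definition coroot (alpha : 'Hom(H, F^o)) : H := xget 0 (is_coroot alpha).

Definition root_reflection (alpha beta : 'Hom(H, F^o)) : 'Hom(H, F^o) :=
  beta - (beta (coroot alpha) : F) *: alpha.

Definition roots_of (S : set L) : set 'Hom(H, F^o) :=
  [set lambda | roots lambda /\
     exists x, [/\ weight_space lambda x, S x & x != 0]].

Definition regular_subalgebra (S : set L) : Prop :=
  is_lie_subalgebra S /\ forall h x, S x -> S (lie (iota h) x).

Definition symmetric_regular_subalgebra (S : set L) : Prop :=
  regular_subalgebra S /\ roots_of S = [set - lambda | lambda in roots_of S].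

Definition maximal_symmetric_regular_subalgebra (S : set L) : Prop :=
  [/\ symmetric_regular_subalgebra S, S <> setT &
      forall S', symmetric_regular_subalgebra S' -> S' <> setT ->
        S `<=` S' -> S' = S].

End Roots.

Section FiniteDimensional.
Variables (F : fieldType) (L : finLieAlgType F).

Definition is_simple_lie : Prop :=
  (exists x y : L, lie x y != 0) /\
  forall I : {vspace L}, (forall x y, y \in I -> lie x y \in I) ->
    I = 0%VS \/ I = fullv.

Definition ad_diagonalizable (h : L) : Prop :=
  exists2 e : seq L, basis_of fullv e &
    forall v, v \in e -> exists a : F, lie h v = a *: v.

(* Over the complex numbers, semisimple means diagonalizable: a Cartan
   subalgebra of a semisimple Lie algebra is a toral subalgebra that is its own
   centralizer. *)
Definition is_cartan_subalgebra (H : {vspace L}) : Prop :=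
  [/\ forall h h', h \in H -> h' \in H -> lie h h' = 0,
      forall h, h \in H -> ad_diagonalizable h &
      forall x, (forall h, h \in H -> lie h x = 0) -> x \in H].

(* On a simple Lie algebra such a form is unique up to a nonzero scalar; the
   Killing form and the normalized invariant form are instances. *)
Record invariant_form := InvariantForm {
  form :> L -> L -> F;
  form_linear : forall y, scalar (form^~ y);
  form_sym : forall x y, form x y = form y x;
  form_invariant : forall x y z, form (lie x y) z = form x (lie y z);
  form_nondegenerate : forall x, (forall y, form x y = 0) -> x = 0 }.

End FiniteDimensional.
Arguments is_simple_lie {F} L.

(* V (x) F[t, t^-1], whose element sum_n v_n (x) t^n is encoded by the finitely
   supported function n |-> v_n. *)
Section LoopSpace.
Variables (F : fieldType) (V : lmodType F).

Definition finsupp_pred : pred (int -> V) :=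
  fun f => `[< finite_set [set n | f n != 0] >].

Lemma finsupp_submod : submod_closed finsupp_pred.
Proof.
split=> [|a f g].
  apply/asboolP; rewrite (_ : [set _ | _] = set0) //.
  by apply/seteqP; split=> n //=; rewrite eqxx.
move=> /asboolP fF /asboolP gF; apply/asboolP.
apply: (@sub_finite_set _ _ ([set n | f n != 0] `|` [set n | g n != 0])).
  move=> n /= nz; have [f0|] := eqVneq (f n) 0; last by left.
  right; apply: contra_neq nz => g0.
  change (a *: f n + g n = 0).
  by rewrite f0 g0 scaler0 addr0.
by rewrite finite_setU.
Qed.

HB.instance Definition _ :=
  GRing.isSubmodClosed.Build F (int -> V) finsupp_pred finsupp_submod.

Record loop := Loop {loop_coef :> int -> V; _ : finsupp_pred loop_coef}.
HB.instance Definition _ := [isSub for loop_coef].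
HB.instance Definition _ := [Choice of loop by <:].
HB.instance Definition _ := [SubChoice_isSubLmodule of loop by <:].

End LoopSpace.

Section AffineAlgebra.
Variables (F : numFieldType) (L : finLieAlgType F) (kappa : invariant_form L).
Local Notation loop := (loop L).
Implicit Types (f g h : loop) (x y z : L) (a : F) (m n : int).

Definition loop_br_fun f g : int -> L :=
  fun n => \sum_(i \in [set: int]) lie (f i) (g (n - i)).

Lemma finite_supp_loop f : finite_set [set n | f n != 0].
Proof. by case: f => f /= /asboolP. Qed.

Lemma loop_off f (A : {fset int}) : [set n | f n != 0] `<=` [set` A] ->
  forall i, i \notin A -> f i = 0.
Proof.
move=> sA i; have [//|fi] := eqVneq (f i) 0.
by move=> /negP[]; exact: (sA i).
Qed.

Lemma loop_br_funE f g (A : {fset int}) : (forall i, i \notin A -> f i = 0) ->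
  forall n, loop_br_fun f g n = \sum_(i <- A) lie (f i) (g (n - i)).
Proof. by move=> fA n; apply: fsbigTE => i /fA ->; rewrite lie0l. Qed.

Lemma loop_fsetP f : exists A : {fset int}, forall i, i \notin A -> f i = 0.
Proof.
exists (fset_set [set n | f n != 0]); apply: loop_off => n.
by rewrite /= in_fset_set ?inE //; exact: finite_supp_loop.
Qed.

Lemma loop_br_subproof f g : finsupp_pred (loop_br_fun f g).
Proof.
have [A fA] := loop_fsetP f; have [B gB] := loop_fsetP g.
apply/asboolP; apply: (@sub_finite_set _ _
  [set` [seq i + j | i <- enum_fset A, j <- enum_fset B]]);
  last exact: finite_seq.
move=> n /=; apply: contra_neqT => nAB.
rewrite (loop_br_funE _ fA) big_seq big1 // => i iA.
rewrite gB ?linear0 //; apply: contra nAB => iB.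
by apply/allpairsP; exists (i, n - i); split => //=; rewrite addrC subrK.
Qed.

(* [v (x) t^m, w (x) t^n] = [v, w] (x) t^(m + n) *)
Definition loop_br f g : loop := Loop (loop_br_subproof f g).

Lemma loop_deg_subproof f : finsupp_pred (fun n => n%:~R *: f n : L).
Proof.
apply/asboolP; apply: sub_finite_set (finite_supp_loop f) => n /=.
by apply: contra_neq => ->; rewrite scaler0.
Qed.

(* t d/dt *)
Definition loop_deg f : loop := Loop (loop_deg_subproof f).

(* the 2-cocycle (v (x) t^m, w (x) t^n) |-> m delta_(m + n, 0) (v | w) *)
Definition loop_cocycle f g : F :=
  \sum_(i \in [set: int]) i%:~R * kappa (f i) (g (- i)).

Lemma monomial_subproof m x : finsupp_pred (fun n => if n == m then x else 0).
Proof.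
apply/asboolP; apply: sub_finite_set (finite_set1 m) => n /=.
by apply: contra_neqP => /eqP/negPf ->.
Qed.

(* x (x) t^m *)
Definition monomial m x : loop := Loop (monomial_subproof m x).

Lemma loopP f g : (forall n, f n = g n) <-> f = g.
Proof. by split=> [fg|-> //]; apply/val_inj/funext. Qed.

Lemma loop0E n : (0 : loop) n = 0. Proof. by []. Qed.
Lemma loopDE f g n : (f + g) n = f n + g n. Proof. by []. Qed.
Lemma loopZE a f n : (a *: f) n = a *: f n. Proof. by []. Qed.
Lemma loopNE f n : (- f) n = - f n. Proof. by []. Qed.

Lemma loop_ind (P : loop -> Prop) :
  P 0 -> (forall f g, P f -> P g -> P (f + g)) ->
  (forall m x, P (monomial m x)) ->
  forall f, P f.
Proof.
move=> P0 PD Pm f; have [A fA] := loop_fsetP f.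
have -> : f = \sum_(i <- A) monomial i (f i).
  apply/loopP => n.
  have E : (\sum_(i <- A) monomial i (f i)) n = \sum_(i <- A) monomial i (f i) n.
    by elim/big_rec2: _ => // i u v _ <-.
  rewrite E /=; have [nA|nA] := boolP (n \in A).
    rewrite (bigD1_seq n) ?fset_uniq //=.
    rewrite big1 ?eqxx ?addr0 // => i; by rewrite eq_sym => /negPf ->.
  rewrite fA // big_seq big1 // => i iA; case: eqVneq => // ni.
  by rewrite -ni fA.
by elim/big_ind: _ => // i u v _ <-.
Qed.

Lemma loop_br_linearl g : linear (loop_br^~ g).
Proof.
move=> a f f'; apply/loopP => n; rewrite loopDE loopZE /=.
have [A fA] := loop_fsetP f; have [B gB] := loop_fsetP f'.
have H1 i : i \notin (A `|` B)%fset -> f i = 0.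
  by rewrite in_fsetU negb_or => /andP[/fA].
have H2 i : i \notin (A `|` B)%fset -> f' i = 0.
  by rewrite in_fsetU negb_or => /andP[_ /gB].
rewrite (loop_br_funE _ H1) (loop_br_funE _ H2) (@loop_br_funE _ _ (A `|` B)%fset).
  rewrite scaler_sumr -big_split; apply: eq_bigr => i _.
  by rewrite loopDE loopZE lieDl lieZl.
by move=> i iN; rewrite loopDE loopZE H1 // H2 // scaler0 addr0.
Qed.

Lemma loop_br_linearr f : linear (loop_br f).
Proof.
move=> a g h; apply/loopP => n; rewrite loopDE loopZE /=.
have [A fA] := loop_fsetP f; rewrite !(loop_br_funE _ fA).
rewrite scaler_sumr -big_split; apply: eq_bigr => i _.
by rewrite loopDE loopZE linearP.
Qed.

Lemma loop_br_monomial m n x y :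
  loop_br (monomial m x) (monomial n y) = monomial (m + n) (lie x y).
Proof.
apply/loopP => k; rewrite /= (@loop_br_funE _ _ [fset m]%fset); last first.
  by move=> i; rewrite in_fset1 /= => /negPf ->.
rewrite big_seq_fset1 /= eqxx subr_eq addrC.
by case: eqP => // _; rewrite linear0.
Qed.

Lemma loop_brDl f f' g : loop_br (f + f') g = loop_br f g + loop_br f' g.
Proof. by have := loop_br_linearl g 1 f f'; rewrite !scale1r. Qed.

Lemma loop_br0l g : loop_br 0 g = 0.
Proof. by apply/(addIr (loop_br 0 g)); rewrite -loop_brDl !add0r. Qed.

Lemma loop_brDr f g h : loop_br f (g + h) = loop_br f g + loop_br f h.
Proof. by have := loop_br_linearr f 1 g h; rewrite !scale1r. Qed.

Lemma loop_br0r f : loop_br f 0 = 0.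
Proof. by apply/(addIr (loop_br f 0)); rewrite -loop_brDr !add0r. Qed.

Lemma monomialD m x y : monomial m (x + y) = monomial m x + monomial m y.
Proof. by apply/loopP => n; rewrite loopDE /=; case: eqP; rewrite ?addr0. Qed.

Lemma monomial0 m : monomial m 0 = 0.
Proof. by apply/loopP => n; rewrite /= if_same. Qed.

Lemma monomialN m x : monomial m (- x) = - monomial m x.
Proof. by apply/loopP => n; rewrite loopNE /=; case: eqP; rewrite ?oppr0. Qed.

Lemma loop_brC f g : loop_br f g = - loop_br g f.
Proof.
elim/loop_ind: f => [|f f' IH IH'|m x]; first by rewrite loop_br0l loop_br0r oppr0.
  by rewrite loop_brDl loop_brDr opprD IH IH'.
elim/loop_ind: g => [|g g' IH IH'|n y]; first by rewrite loop_br0l loop_br0r oppr0.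
  by rewrite loop_brDl loop_brDr opprD IH IH'.
by rewrite !loop_br_monomial addrC lieC monomialN.
Qed.

Lemma addr_eqNself (W : lmodType F) (w : W) : w = - w -> w = 0.
Proof.
move=> /eqP; rewrite -addr_eq0 -mulr2n -scaler_nat scaler_eq0 pnatr_eq0 /=.
by move/eqP.
Qed.

Lemma loop_brxx f : loop_br f f = 0.
Proof. exact/addr_eqNself/loop_brC. Qed.

Lemma loop_jacobi f g h :
  loop_br f (loop_br g h) + loop_br g (loop_br h f) +
  loop_br h (loop_br f g) = 0.
Proof.
have aux (u u' v v' w w' : loop) :
    u + v + w = 0 -> u' + v' + w' = 0 -> u + u' + (v + v') + (w + w') = 0.
  by move=> E E'; rewrite (addrACA u) (addrACA (u + v)) E E' addr0.
elim/loop_ind: f => [|f f' IH IH'|m x].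
- by rewrite !(loop_br0l, loop_br0r) !addr0.
- by rewrite !(loop_brDl, loop_brDr); exact: aux.
elim/loop_ind: g => [|g g' IH IH'|n y].
- by rewrite !(loop_br0l, loop_br0r) !addr0.
- by rewrite !(loop_brDl, loop_brDr); exact: aux.
elim/loop_ind: h => [|h h' IH IH'|k z].
- by rewrite !(loop_br0l, loop_br0r) !addr0.
- by rewrite !(loop_brDl, loop_brDr); exact: aux.
rewrite !loop_br_monomial.
have -> : n + (k + m) = m + (n + k) by rewrite addrA addrC.
have -> : k + (m + n) = m + (n + k) by rewrite addrC addrA.
by rewrite -!monomialD lie_jacobi monomial0.
Qed.

Lemma loop_deg_linear : linear loop_deg.
Proof.
move=> a f g; apply/loopP => n.
rewrite loopDE loopZE /=.
change (n%:~R *: (a *: f n + g n) = a *: (n%:~R *: f n) + n%:~R *: g n).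
by rewrite scalerDr !scalerA mulrC.
Qed.

Lemma loop_degD f g : loop_deg (f + g) = loop_deg f + loop_deg g.
Proof. by have := loop_deg_linear 1 f g; rewrite !scale1r. Qed.

Lemma loop_degZ a f : loop_deg (a *: f) = a *: loop_deg f.
Proof.
apply/loopP => n; change (n%:~R *: (a *: f n) = a *: (n%:~R *: f n)).
by rewrite !scalerA mulrC.
Qed.

Lemma loop_deg0 : loop_deg 0 = 0.
Proof. by apply/loopP => n; change (n%:~R *: (0 : L) = 0); rewrite scaler0. Qed.

Lemma loop_degN f : loop_deg (- f) = - loop_deg f.
Proof.
apply/loopP => n; change (n%:~R *: - f n = - (n%:~R *: f n)).
by rewrite scalerN.
Qed.

Lemma loop_deg_br f g :
  loop_deg (loop_br f g) = loop_br (loop_deg f) g + loop_br f (loop_deg g).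
Proof.
have [A fA] := loop_fsetP f; apply/loopP => n; rewrite loopDE /=.
have dfA i : i \notin A -> loop_deg f i = 0 by move=> /fA /= ->; rewrite scaler0.
rewrite (loop_br_funE _ fA) (loop_br_funE _ fA) (loop_br_funE _ dfA).
rewrite scaler_sumr -big_split; apply: eq_bigr => i _ /=.
by rewrite lieZl linearZ -scalerDl -intrD (addrC i) subrK.
Qed.

Lemma form0l y : kappa 0 y = 0.
Proof.
by have := @form_linear _ _ kappa y (-1) 0 0; rewrite scaler0 addr0 mulN1r addNr.
Qed.

Lemma formDl x x' y : kappa (x + x') y = kappa x y + kappa x' y.
Proof. by have := @form_linear _ _ kappa y 1 x x'; rewrite scale1r mul1r. Qed.

Lemma formZl a x y : kappa (a *: x) y = a * kappa x y.
Proof.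
by have := @form_linear _ _ kappa y a x 0; rewrite form0l !addr0.
Qed.

Lemma loop_cocycleE f g (A : {fset int}) : (forall i, i \notin A -> f i = 0) ->
  loop_cocycle f g = \sum_(i <- A) i%:~R * kappa (f i) (g (- i)).
Proof. by move=> fA; apply: fsbigTE => i /fA ->; rewrite form0l mulr0. Qed.

Lemma loop_cocycle_linearl g : scalar (loop_cocycle^~ g).
Proof.
move=> a f f'.
have [A fA] := loop_fsetP f; have [B gB] := loop_fsetP f'.
have H1 i : i \notin (A `|` B)%fset -> f i = 0.
  by rewrite in_fsetU negb_or => /andP[/fA].
have H2 i : i \notin (A `|` B)%fset -> f' i = 0.
  by rewrite in_fsetU negb_or => /andP[_ /gB].
rewrite (loop_cocycleE _ H1) (loop_cocycleE _ H2).
rewrite (@loop_cocycleE _ _ (A `|` B)%fset).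
  rewrite mulr_sumr -big_split; apply: eq_bigr => i _.
  by rewrite loopDE loopZE formDl formZl mulrDr mulrCA.
by move=> i iN; rewrite loopDE loopZE H1 // H2 // scaler0 addr0.
Qed.

Lemma loop_cocycleDl f f' g :
  loop_cocycle (f + f') g = loop_cocycle f g + loop_cocycle f' g.
Proof. by have := loop_cocycle_linearl g 1 f f'; rewrite scale1r mul1r. Qed.

Lemma loop_cocycle0l g : loop_cocycle 0 g = 0.
Proof. by apply/(addIr (loop_cocycle 0 g)); rewrite -loop_cocycleDl !add0r. Qed.

Lemma loop_cocycleZl a f g : loop_cocycle (a *: f) g = a * loop_cocycle f g.
Proof.
by have := loop_cocycle_linearl g a f 0; rewrite loop_cocycle0l !addr0.
Qed.

Lemma loop_cocycleC f g : loop_cocycle f g = - loop_cocycle g f.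
Proof.
rewrite /loop_cocycle (@reindex_fsbigT _ _ _ _ _ (fun i : int => - i)) /=; last first.
  by exists -%R => i; rewrite opprK.
have [A fA] := loop_fsetP g; rewrite (@fsbigTE _ _ _ _ A); last first.
  by move=> i /fA gi; rewrite opprK gi form_sym form0l mulr0.
rewrite (@fsbigTE _ _ _ _ A); last by move=> i /fA gi; rewrite gi form0l mulr0.
rewrite -sumrN; apply: eq_bigr => i _.
by rewrite opprK intrN mulNr form_sym.
Qed.

Lemma loop_cocycleDr f g h :
  loop_cocycle f (g + h) = loop_cocycle f g + loop_cocycle f h.
Proof. by rewrite loop_cocycleC loop_cocycleDl opprD -!(loop_cocycleC f). Qed.

Lemma loop_cocycle0r f : loop_cocycle f 0 = 0.
Proof. by rewrite loop_cocycleC loop_cocycle0l oppr0. Qed.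

Lemma loop_cocycleZr a f g : loop_cocycle f (a *: g) = a * loop_cocycle f g.
Proof. by rewrite loop_cocycleC loop_cocycleZl (loop_cocycleC f g) mulrN. Qed.

Lemma loop_cocyclexx f : loop_cocycle f f = 0.
Proof. exact: (@addr_eqNself F^o _ (loop_cocycleC f f)). Qed.

Lemma loop_cocycle_monomial m n x y :
  loop_cocycle (monomial m x) (monomial n y) =
  if m + n == 0 then m%:~R * kappa x y else 0.
Proof.
rewrite (@loop_cocycleE _ _ [fset m]%fset); last first.
  by move=> i; rewrite in_fset1 /= => /negPf ->.
rewrite big_seq_fset1 /= eqxx addr_eq0 eqr_oppLR.
by case: eqP => // _; rewrite form_sym form0l mulr0.
Qed.

Lemma loop_cocycle_jacobi f g h :
  loop_cocycle f (loop_br g h) + loop_cocycle g (loop_br h f) +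
  loop_cocycle h (loop_br f g) = 0.
Proof.
have aux (u u' v v' w w' : F) :
    u + v + w = 0 -> u' + v' + w' = 0 -> u + u' + (v + v') + (w + w') = 0.
  by move=> E E'; rewrite (addrACA u) (addrACA (u + v)) E E' addr0.
have simp := (loop_br0l, loop_br0r, loop_cocycle0l, loop_cocycle0r).
have simpD := (loop_brDl, loop_brDr, loop_cocycleDl, loop_cocycleDr).
elim/loop_ind: f => [|f f' IH IH'|m x].
- by rewrite !simp !addr0.
- by rewrite !simpD; exact: aux.
elim/loop_ind: g => [|g g' IH IH'|n y].
- by rewrite !simp !addr0.
- by rewrite !simpD; exact: aux.
elim/loop_ind: h => [|h h' IH IH'|k z].
- by rewrite !simp !addr0.
- by rewrite !simpD; exact: aux.
rewrite !loop_br_monomial !loop_cocycle_monomial.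
have -> : n + (k + m) = m + (n + k) by rewrite addrA addrC.
have -> : k + (m + n) = m + (n + k) by rewrite addrC addrA.
case: eqP => [mnk|_]; last by rewrite !addr0.
have -> : kappa y (lie z x) = kappa x (lie y z).
  by rewrite -form_invariant form_sym.
have -> : kappa z (lie x y) = kappa x (lie y z).
  by rewrite form_sym form_invariant.
by rewrite -!mulrDl -!intrD -addrA mnk mul0r.
Qed.

Lemma loop_cocycle_deg f g :
  loop_cocycle (loop_deg f) g + loop_cocycle f (loop_deg g) = 0.
Proof.
have [A fA] := loop_fsetP f.
have dfA i : i \notin A -> loop_deg f i = 0 by move=> /fA /= ->; rewrite scaler0.
rewrite (loop_cocycleE _ fA) (loop_cocycleE _ dfA) -big_split big1 // => i _ /=.
rewrite formZl (form_sym _ (f i) (_ *: _)) formZl form_sym intrN.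
by rewrite mulNr mulrN subrr.
Qed.

(* (f, a, b) encodes f + a c + b d. The bracket depends on the form. *)
Definition affine_algebra (_ : invariant_form L) : Type :=
  (loop * F^o * F^o)%type.
HB.instance Definition _ k :=
  GRing.Lmodule.copy (affine_algebra k) (loop * F^o * F^o)%type.
Local Notation affine := (affine_algebra kappa).

Definition affine_br (u v : affine) : affine :=
  (loop_br u.1.1 v.1.1 + (u.2 : F) *: loop_deg v.1.1
     - (v.2 : F) *: loop_deg u.1.1,
   loop_cocycle u.1.1 v.1.1, 0).

Lemma affineP (u v : affine) :
  u.1.1 = v.1.1 -> u.1.2 = v.1.2 -> u.2 = v.2 -> u = v.
Proof. by case: u => [[? ?] ?]; case: v => [[? ?] ?] /= -> -> ->. Qed.

Lemma coord_inj x y :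
  (forall i, coord (vbasis {:L}) i x = coord (vbasis {:L}) i y) -> x = y.
Proof.
move=> E; rewrite (coord_vbasis (memvf x)) (coord_vbasis (memvf y)).
by apply: eq_bigr => i _; rewrite E.
Qed.

(* identities between linear combinations in loop, checked coordinatewise *)
Ltac loop_ring :=
  apply/loopP => ?; apply: coord_inj => ?;
  rewrite /loop_deg ?(loopDE, loopNE, loopZE, loop0E) /=;
  rewrite ?(loopDE, loopNE, loopZE, loop0E);
  rewrite ?(linearD, linearN, linearZ, linear0) /=; ring.

Lemma affine_br_linearl v : linear (affine_br^~ v).
Proof.
move=> a u u'; apply: affineP => /=; last by rewrite scaler0 addr0.
  rewrite loop_br_linearl loop_deg_linear.
  have -> : a *: u.2 + u'.2 = a * (u.2 : F) + u'.2 by [].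
  move: (u.2 : F) (u'.2 : F) (v.2 : F) => b b' c.
  by loop_ring.
exact: (loop_cocycle_linearl v.1.1 a u.1.1 u'.1.1).
Qed.

Lemma affine_brxx u : affine_br u u = 0.
Proof.
by apply: affineP => //=; [rewrite loop_brxx add0r subrr | exact: loop_cocyclexx].
Qed.

Lemma affine_br_linearr u : linear (affine_br u).
Proof.
have brC v w : affine_br v w = - affine_br w v.
  apply: affineP => /=; last by rewrite oppr0.
    by rewrite (loop_brC w.1.1) !opprD !opprK -addrA (addrC (_ *: _)) addrA.
  exact: loop_cocycleC.
move=> a v v'.
by rewrite !(brC u) affine_br_linearl opprD scalerN.
Qed.

Lemma affine_jacobi u v w :
  affine_br u (affine_br v w) + affine_br v (affine_br w u) +
  affine_br w (affine_br u v) = 0.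
Proof.
apply: affineP; last by rewrite /= !addr0.
  move: u v w => [[f a'] a] [[g b'] b] [[h c'] c] /=.
  rewrite !(loop_degD, loop_degN, loop_degZ, loop_deg_br).
  rewrite !scale0r !subr0.
  have brZr a0 (f0 g0 : loop) : loop_br f0 (a0 *: g0) = a0 *: loop_br f0 g0.
    by have := loop_br_linearr f0 a0 g0 0; rewrite loop_br0r !addr0.
  have brNr (f0 g0 : loop) : loop_br f0 (- g0) = - loop_br f0 g0.
    by rewrite -scaleN1r brZr scaleN1r.
  rewrite !(loop_brDr, brNr, brZr).
  rewrite (loop_brC (loop_deg f)) (loop_brC (loop_deg g)) (loop_brC (loop_deg h)).
  have -> : loop_br f (loop_br g h) =
      - loop_br g (loop_br h f) - loop_br h (loop_br f g).
    by rewrite -opprD; apply/eqP; rewrite -addr_eq0 addrA loop_jacobi.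
  by loop_ring.
move: u v w => [[f a'] a] [[g b'] b] [[h c'] c] /=.
have cocNr (f0 g0 : loop) : loop_cocycle f0 (- g0) = - loop_cocycle f0 g0.
  by rewrite -scaleN1r loop_cocycleZr mulN1r.
change (loop_cocycle f (loop_br g h + b *: loop_deg h - c *: loop_deg g) +
  loop_cocycle g (loop_br h f + c *: loop_deg f - a *: loop_deg h) +
  loop_cocycle h (loop_br f g + a *: loop_deg g - b *: loop_deg f) = 0 :> F).
have J := loop_cocycle_jacobi f g h.
have degC (f0 g0 : loop) :
    loop_cocycle f0 (loop_deg g0) = loop_cocycle g0 (loop_deg f0).
  have := loop_cocycle_deg f0 g0; rewrite (loop_cocycleC (loop_deg f0)) addrC.
  by move/eqP; rewrite subr_eq0 => /eqP.
rewrite !(loop_cocycleDr, cocNr, loop_cocycleZr) -[RHS]J.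
by rewrite (degC h f) (degC h g) (degC g f); ring.
Qed.

HB.instance Definition _ := isLieAlgebra.Build F affine
  affine_br_linearl affine_br_linearr affine_brxx affine_jacobi.

End AffineAlgebra.

Section AffineRoots.
Variables (F : numFieldType) (L : finLieAlgType F) (kappa : invariant_form L).
Variable (H : {vspace L}).

Definition affine_cartan : Type := (subvs_of H * F^o * F^o)%type.
HB.instance Definition _ :=
  Vector.copy affine_cartan (subvs_of H * F^o * F^o)%type.

Definition affine_cartan_incl (h : affine_cartan) : affine_algebra kappa :=
  (monomial 0 (vsval h.1.1), h.1.2, h.2).

Definition affine_dual := 'Hom(affine_cartan, F^o).

(* alpha extended by alpha(c) = alpha(d) = 0 *)
Definition ext_root (alpha : 'Hom(subvs_of H, F^o)) : affine_dual :=
  (alpha \o linfun (fst \o fst : affine_cartan -> subvs_of H))%VF.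

Lemma ext_rootE alpha (h : affine_cartan) : ext_root alpha h = alpha h.1.1.
Proof. by rewrite comp_lfunE lfunE. Qed.

Definition delta : affine_dual := linfun (snd : affine_cartan -> F^o).

Lemma deltaE (h : affine_cartan) : delta h = h.2.
Proof. by rewrite lfunE. Qed.

Definition real_roots : set affine_dual :=
  [set lambda | exists alpha (r : int),
     roots (@vsval _ _ H) alpha /\
     lambda = ext_root alpha + r%:~R *: delta].

Definition affine_reflection : affine_dual -> affine_dual -> affine_dual :=
  root_reflection affine_cartan_incl.

Definition real_closed_subroot_system (Psi : set affine_dual) : Prop :=
  [/\ Psi !=set0, Psi `<=` real_roots,
      forall alpha beta, Psi alpha -> Psi beta ->
        Psi (affine_reflection alpha beta) &
      forall alpha beta, Psi alpha -> Psi beta -> real_roots (alpha + beta) ->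
        Psi (alpha + beta)].

Definition maximal_real_closed_subroot_system (Psi : set affine_dual) : Prop :=
  [/\ real_closed_subroot_system Psi, Psi <> real_roots &
      forall Psi', real_closed_subroot_system Psi' -> Psi' <> real_roots ->
        Psi `<=` Psi' -> Psi' = Psi].

End AffineRoots.
Arguments affine_cartan_incl {F L} kappa H.
Arguments real_roots {F L} H.

(* Main.v *)
From HB Require Import structures.
From mathcomp Require Import all_boot all_order all_algebra.
From mathcomp Require Import finmap complex.
From mathcomp Require Import all_classical all_reals.
From mathcomp Require Import ring zify.
Require Import Defs.

Set Implicit Arguments.
Unset Strict Implicit.
Unset Printing Implicit Defensive.

Import Order.TTheory GRing.Theory Num.Theory.

Local Open Scope classical_set_scope.
Local Open Scope ring_scope.

(* Write a regular subalgebra as a sum of weight spaces. Its real roots form a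
   real closed subroot system Psi or the empty set. Conversely, among the
   symmetric regular subalgebras with real roots Psi there is a largest one,
   spanned by the Cartan subalgebra, the real root spaces of Psi, and the
   h (x) t^r with h in the Cartan subalgebra such that translation by r delta
   preserves every fibre of Psi over a root not vanishing on h. The bijection
   maps Psi to this subalgebra.

   The point is that maximality of the subalgebra forces maximality of Psi. If
   Psi does not have all finite roots as gradients, it is the full preimage of
   its set of gradients. Otherwise the translations preserving the fibres of Psi
   are the same for all finite roots, because the finite root system is
   irreducible, so that enlarging Psi also enlarges the imaginary part.

   In rank one the loop algebra of the Cartan subalgebra, extended by c and d,
   may be one more maximal symmetric regular subalgebra; it has no real roots.
   It is accommodated because there are infinitely many maximal real closed
   subroot systems, one for every prime p: those with all real roots
   alpha + p s delta.

   The invariant form replaces the Killing form in the structure theory of the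
   finite-dimensional algebra. *)

(* A set of integers closed under (x, y) |-> 2 x - y is an arithmetic
   progression, of which t is a multiple of the step; the proof is Euclid's
   algorithm on t and s - r. *)
Lemma reflection_closed_shift (Z : set int) :
  (forall x y, Z x -> Z y -> Z (2%:R * x - y)) ->
  forall r t s : int, Z r -> Z (r + t) -> Z s -> Z (s + t).
Proof.
move=> ZR r t s Zr Zrt Zs.
pose Y (x : int) := Z (r + x).
have YR x y : Y x -> Y y -> Y (2%:R * x - y).
  by move=> Yx Yy; have := ZR _ _ Yx Yy; congr Z; ring.
have Y0 : Y 0 by rewrite /Y addr0.
have YN x : Y x -> Y (- x) by move=> Yx; have := YR _ _ Y0 Yx; congr Y; ring.
have YA x y : Y x -> Y y -> Y (y + 2%:R * x).
  by move=> Yx Yy; have := YR _ _ Yx (YN _ Yy); congr Y; ring.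
suff main n x y : (`|x| + `|y| < n)%N -> Y x -> Y y -> Y (x + y).
  have := main _ t (s - r) (ltnSn _); rewrite /Y => /(_ Zrt).
  by rewrite (addrC r) subrK => /(_ Zs); congr Z; ring.
elim: n x y => [//|n IH] x y xyn Yx Yy.
wlog yx : x y xyn Yx Yy / (`|y| <= `|x|)%N.
  move=> W0; have [/W0|/ltnW/W0] := leqP `|y|%N `|x|%N; first exact.
  by rewrite (addnC `|y|%N) (addrC y); apply.
have [->|y0] := eqVneq y 0; first by rewrite addr0.
have Yxy : Y (x - 2%:R * y).
  by have := YA _ _ (YN _ Yy) Yx; congr Y; ring.
have Yxy' : Y (x + 2%:R * y) by exact: YA.
have [xx|xx] := eqVneq x y.
  by have := YA _ _ Yx Y0; rewrite xx; congr Y; ring.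
have [xNy|xNy] := eqVneq x (- y); first by rewrite xNy addNr.
(* A Euclidean step: by now [0 < |y| < |x|], so replacing [x] by [x - 2y] or [x + 2y], according to
   the sign of [x * y], makes [|x|] smaller. *)
have [s0|s0] := leP 0 (x * y).
  have := IH (x - 2%:R * y) y; rewrite (_ : x - _ + y = x - y); last by ring.
  move=> H1; have : Y (x - y) by apply: H1 => //; nia.
  by move=> Yd; have := YA _ _ Yy Yd; congr Y; ring.
have := IH (x + 2%:R * y) (- y); rewrite (_ : x + _ - y = x + y); last by ring.
by apply => //; [nia | exact: YN].
Qed.

(** * Subspaces and spans in a Lie algebra *)

Section Subspace.
Variables (F : fieldType) (L : lieAlgType F).
Implicit Types (S : set L) (G : set L).

Definition lspan G : set L := smallest (@is_subspace F L) G.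

Lemma subspace0 S : is_subspace S -> S 0. Proof. by case. Qed.

Lemma subspaceD S x y : is_subspace S -> S x -> S y -> S (x + y).
Proof. by move=> [_ SP] Sx Sy; rewrite -[x]scale1r; apply: SP. Qed.

Lemma subspaceZ S a x : is_subspace S -> S x -> S (a *: x).
Proof. by move=> [S0 SP] Sx; rewrite -[_ *: x]addr0; apply: SP. Qed.

Lemma subspaceN S x : is_subspace S -> S x -> S (- x).
Proof. by move=> sS Sx; rewrite -scaleN1r; apply: subspaceZ. Qed.

Lemma subspaceB S x y : is_subspace S -> S x -> S y -> S (x - y).
Proof.
by move=> sS Sx Sy; apply: subspaceD => //; exact: subspaceN.
Qed.

Lemma subspace_scale S a x : is_subspace S -> a != 0 -> S (a *: x) -> S x.
Proof.
by move=> sS a0 /(subspaceZ (a^-1) sS); rewrite scalerA mulVf // scale1r.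
Qed.

Lemma subspace_sum S (I : Type) (r : seq I) (P : pred I) (w : I -> L) :
  is_subspace S -> (forall i, P i -> S (w i)) -> S (\sum_(i <- r | P i) w i).
Proof.
move=> sS Sw; apply: (big_ind S) => //; first exact: subspace0.
by move=> x y; exact: subspaceD.
Qed.

Lemma lspan_subspace G : is_subspace (lspan G).
Proof.
split=> [S [sS _]|a x y Gx Gy S SG]; first exact: subspace0.
by apply: SG.1.2; [exact: Gx | exact: Gy].
Qed.

Lemma lspan_gen G x : G x -> lspan G x.
Proof. by move=> Gx S [_]; apply. Qed.

Lemma lspan_min G S : is_subspace S -> G `<=` S -> lspan G `<=` S.
Proof. by move=> sS GS x; apply; split. Qed.

Lemma lie0r (x : L) : lie x 0 = 0. Proof. exact: linear0. Qed.

Lemma lieDr (x y z : L) : lie x (y + z) = lie x y + lie x z.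
Proof. exact: linearD. Qed.

Lemma lieZr a (x y : L) : lie x (a *: y) = a *: lie x y.
Proof. exact: linearZ. Qed.

Lemma lieNr (x y : L) : lie x (- y) = - lie x y.
Proof. exact: linearN. Qed.

Lemma lie_sumr (I : Type) (r : seq I) (P : pred I) (w : I -> L) y :
  lie y (\sum_(i <- r | P i) w i) = \sum_(i <- r | P i) lie y (w i).
Proof. exact: linear_sum. Qed.

Lemma lie_suml (I : Type) (r : seq I) (P : pred I) (w : I -> L) y :
  lie (\sum_(i <- r | P i) w i) y = \sum_(i <- r | P i) lie (w i) y.
Proof.
rewrite lieC lie_sumr -sumrN; apply: eq_bigr => i _.
by rewrite [in RHS]lieC.
Qed.

Lemma lie_derivation (x y z : L) :
  lie x (lie y z) = lie (lie x y) z + lie y (lie x z).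
Proof.
have /eqP := lie_jacobi x y z.
rewrite (lieC z (lie x y)) (lieC z x) lieNr subr_eq0 => /eqP <-.
by rewrite addrNK.
Qed.

End Subspace.

(** * Sums of simultaneous eigenvectors *)

Section Decomposition.
Variables (F : fieldType) (L : lieAlgType F) (I : Type) (x : I -> L).
Variables (T : eqType) (ev : T -> I -> F).
Hypothesis ev_sep : forall s t, s != t -> exists i, ev s i != ev t i.

Definition weight_vector t (v : L) : Prop := forall i, lie (x i) v = ev t i *: v.

Lemma weight_vector_subspace t : is_subspace (weight_vector t).
Proof.
split=> [i|a u v wu wv i]; first by rewrite lie0r scaler0.
by rewrite lieDr lieZr wu wv scalerDr !scalerA mulrC.
Qed.

Lemma weight_vector0 t : weight_vector t 0.
Proof. exact: (weight_vector_subspace t).1. Qed.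

Definition decomposable (v : L) : Prop := exists (s : seq T) (w : T -> L),
  [/\ uniq s, forall t, weight_vector t (w t) & v = \sum_(t <- s) w t].

Lemma decomposable_subspace : is_subspace decomposable.
Proof.
split=> [|a u v [s1 [w1 [us1 ww1 ->]]] [s2 [w2 [us2 ww2 ->]]]].
  exists [::], (fun=> 0); rewrite big_nil; split => // t.
  exact: weight_vector0.
(* Extension by zero off [s], so that both families can be summed over the union of the two index
   lists. *)
pose cut (s : seq T) (w : T -> L) t := if t \in s then w t else 0.
have cutW s w t : weight_vector t (w t) -> weight_vector t (cut s w t).
  by rewrite /cut; case: ifP => // _ _; exact: weight_vector0.
have cut_sum s s' (w : T -> L) : uniq s -> uniq s' -> {subset s <= s'} ->
    \sum_(t <- s) w t = \sum_(t <- s') cut s w t.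
  move=> us us' ss'; rewrite -big_mkcond -big_filter; apply: perm_big.
  apply: uniq_perm => //; first exact: filter_uniq.
  by move=> t; rewrite mem_filter; apply/idP/andP=> [ts|[]//]; split=> //; exact: ss'.
exists (undup (s1 ++ s2)), (fun t => a *: cut s1 w1 t + cut s2 w2 t).
split; first exact: undup_uniq.
  by move=> t; apply: (weight_vector_subspace t).2; apply: cutW.
rewrite big_split /= -scaler_sumr -!cut_sum ?undup_uniq //.
  by move=> t ts; rewrite mem_undup mem_cat ts orbT.
by move=> t ts; rewrite mem_undup mem_cat ts.
Qed.

Lemma weight_vector_decomposable t v : weight_vector t v -> decomposable v.
Proof.
move=> wv; exists [:: t], (fun u => if u == t then v else 0); split=> //.
  move=> u; case: eqP => [->//|_].
  exact: weight_vector0.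
by rewrite big_seq1 eqxx.
Qed.

(* Applying ad (x i) - ev t i to a sum of weight vectors kills the component of
   weight t and rescales the component of weight u by ev u i - ev t i. *)
Lemma component_mem (W : set L) (s : seq T) (w : T -> L) :
  is_subspace W -> (forall i v, W v -> W (lie (x i) v)) ->
  uniq s -> (forall t, weight_vector t (w t)) ->
  W (\sum_(t <- s) w t) -> forall t, t \in s -> W (w t).
Proof.
move=> sW stW; elim: s w => [//|t s IH] w /= /andP[ts us] ww.
rewrite big_cons => Wsum.
have Ws u : u \in s -> W (w u).
  move=> us'; have /ev_sep[i ui] : u != t by apply: contraNneq ts => <-.
  apply: (@subspace_scale _ _ _ (ev u i - ev t i)) => //; first by rewrite subr_eq0.
  apply: (IH (fun v => (ev v i - ev t i) *: w v)) => // [v|].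
    exact: (subspaceZ _ (weight_vector_subspace v) (ww v)).
  have := subspaceB sW (stW i _ Wsum) (subspaceZ (ev t i) sW Wsum).
  rewrite lieDr ww scalerDr opprD addrACA subrr add0r lie_sumr scaler_sumr.
  rewrite -sumrB; under eq_bigr => v _ do rewrite ww -scalerBl.
  by [].
move=> u; rewrite inE => /orP[/eqP->|]; last exact: Ws.
rewrite -[w t](addrK (\sum_(v <- s) w v)); apply: subspaceB => //.
by rewrite big_seq; apply: subspace_sum.
Qed.

End Decomposition.

(** * A single ad-diagonalizable element *)

Section AdDiagonalizable.
Variables (F : fieldType) (L : finLieAlgType F) (h : L).
Hypothesis diag_h : ad_diagonalizable h.

Let eigenbasis : exists n (e : n.-tuple L) (a : 'I_n -> F),
  basis_of fullv e /\ forall i : 'I_n, lie h e`_i = a i *: e`_i.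
Proof.
have [e be he] := diag_h.
have /choice[a ha] : forall i : 'I_(size e), exists c, lie h e`_i = c *: e`_i.
  by move=> i; apply: he; rewrite mem_nth.
by exists (size e), (in_tuple e), a.
Qed.

(** Eigenvalues serve as weights and [unit] as index type, so that [component_mem] applies to one
    operator. *)
Lemma ad_decomposable x :
  decomposable (fun _ : unit => h) (fun (c : F) (_ : unit) => c) x.
Proof.
have [n [e [a [be he]]]] := eigenbasis.
rewrite (coord_basis be (memvf x)); apply: subspace_sum.
  exact: decomposable_subspace.
move=> i _; apply: subspaceZ; first exact: decomposable_subspace.
by apply: (weight_vector_decomposable (t := a i)) => _; exact: he.
Qed.

Lemma ad_finite_spectrum : exists s : seq F,
  forall c x, x != 0 -> lie h x = c *: x -> c \in s.
Proof.
have [n [e [a [be he]]]] := eigenbasis.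
exists (codom a) => c x x0 hx; apply: contraNT x0 => ca.
rewrite (coord_basis be (memvf x)) big1 // => i _.
suff -> : coord e i x = 0 by rewrite scale0r.
have /freeP fe := basis_free be.
have : (a i - c) * coord e i x = 0.
  apply: (fe (fun i => (a i - c) * coord e i x)).
  under eq_bigr => j _ do rewrite mulrC -scalerA scalerBl scalerBr -he.
  rewrite sumrB; under eq_bigr => j _ do rewrite -lieZr.
  under [X in _ - X]eq_bigr => j _ do rewrite scalerA mulrC -scalerA.
  by rewrite -lie_sumr -scaler_sumr -(coord_basis be (memvf x)) hx subrr.
move=> /eqP; rewrite mulf_eq0 subr_eq0 => /orP[/eqP ac|/eqP//].
by rewrite -ac codom_f in ca.
Qed.

End AdDiagonalizable.

(** * Strings below a vector killed by the raising operator *)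

Section Ladder.
Variables (F : fieldType) (L : lieAlgType F) (x y v : L) (c : nat -> F).
Hypothesis xv : lie x v = 0.
Hypothesis hv : forall k,
  lie (lie x y) (iter k (lie y) v) = c k *: iter k (lie y) v.

(** Commuting [x] past one [y] at a time contributes one [c j] each. Arbitrary scalars serve both
    sl2, where they decrease by 2, and the Heisenberg algebra, where they are constant. *)
Lemma ladder k : lie x (iter k.+1 (lie y) v) =
  (\sum_(j < k.+1) c j) *: iter k (lie y) v.
Proof.
elim: k => [|k IH].
  by rewrite big_ord_recl big_ord0 addr0 iterS lie_derivation hv /= xv lie0r addr0.
rewrite iterS lie_derivation hv IH lieZr -iterS -scalerDl.
by rewrite [in RHS]big_ord_recr addrC.
Qed.

(** If one more [y] gave 0, then [ladder] would express 0 as a nonzero multiple of a vector already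
    known to be nonzero. *)
Lemma ladder_nz n : v != 0 -> (forall k, (k < n)%N -> \sum_(j < k.+1) c j != 0) ->
  iter n (lie y) v != 0.
Proof.
move=> v0; elim: n => [//|n IH] cn.
have wn0 : iter n (lie y) v != 0 by apply: IH => k /ltnW; exact: cn.
apply: contraNneq (cn n (ltnSn n)) => wn.
have := ladder n; rewrite wn lie0r => /esym/eqP.
by rewrite scaler_eq0 (negPf wn0) orbF.
Qed.

End Ladder.

(** * Root spaces of the simple Lie algebra *)

Section RootSpaces.
Variables (F : numFieldType) (L : finLieAlgType F) (kappa : invariant_form L).
Variable (H : {vspace L}).
Hypotheses (simpleL : is_simple_lie L) (cartanH : is_cartan_subalgebra H).

Local Notation dual := 'Hom(subvs_of H, F^o).
Local Notation W := (weight_space (@vsval _ _ H)).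
Local Notation D := (roots (@vsval _ _ H)).
Implicit Types (a b : dual) (x y : L) (h : subvs_of H).

Lemma dual_sep a b : a != b -> exists h, (a h : F) != b h.
Proof.
move=> ab; apply: contrapT => nh; move/eqP: ab; apply; apply/lfunP => h.
by apply: contrapT => /eqP abh; apply: nh; exists h.
Qed.

Lemma dual_nz a : a != 0 -> exists h, (a h : F) != 0.
Proof. by move=> /dual_sep[h]; rewrite lfunE; exists h. Qed.

Lemma weight_space_subspace a : is_subspace (W a).
Proof. exact: weight_vector_subspace. Qed.

Lemma weight_space0 a : W a 0.
Proof. exact: weight_vector0. Qed.

Lemma weight_spaceZ a c x : W a x -> W a (c *: x).
Proof. exact: (subspaceZ c (weight_space_subspace a)). Qed.

Lemma weight_space_lie a b x y : W a x -> W b y -> W (a + b) (lie x y).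
Proof.
move=> wx wy h; rewrite lie_derivation wx wy lieZl lieZr -scalerDl.
by rewrite add_lfunE.
Qed.

Lemma cartan_lie0 x y : x \in H -> y \in H -> lie x y = 0.
Proof. by case: cartanH => + _ _; apply. Qed.

Lemma weight_space0E x : W 0 x <-> x \in H.
Proof.
case: cartanH => abH _ cH; split=> [wx|xH h].
  by apply: cH => h hH; have := wx (vsproj H h); rewrite vsprojK // lfunE /= scale0r.
by rewrite cartan_lie0 ?subvsP // lfunE /= scale0r.
Qed.

(** The eigenvalue depends linearly on [h] because the bracket does and [x] is nonzero. *)
Lemma eigenvector_weight x : x != 0 ->
  (forall h, exists c, lie (vsval h) x = c *: x) -> exists a, W a x.
Proof.
move=> x0 /choice[c hc].
have cl : linear (c : _ -> F^o).
  move=> k h h'; apply/eqP; rewrite -subr_eq0; apply/eqP.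
  have /eqP := hc (k *: h + h').
  rewrite linearP lieDl lieZl !hc scalerA -scalerDl -subr_eq0 -scalerBl scaler_eq0.
  rewrite (negPf x0) orbF subr_eq0 => /eqP <-.
  by rewrite subrr.
pose cL : {linear subvs_of H -> F^o} :=
  HB.pack c (GRing.isLinear.Build F _ F^o *:%R c cl).
by exists (linfun cL) => h; rewrite hc lfunE.
Qed.

(** Simultaneous diagonalization, one basis vector of [H] at a time: the next one commutes with the
    others, so it preserves their joint eigenspaces, and its eigencomponents stay there. *)
Lemma weight_decomposable x :
  decomposable (@vsval _ _ H) (fun a h => a h : F) x.
Proof.
have [abH dgH cH] := cartanH.
pose Q (hs : seq L) := [set x : L | forall u, u \in hs -> exists c, lie u x = c *: x].
have QT (hs : seq L) : {subset hs <= H} -> forall x, lspan (Q hs) x.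
  elim: hs => [_ z|g hs IH sH z]; first exact: lspan_gen.
  have gH : g \in H by apply: sH; rewrite inE eqxx.
  have {}IH : lspan (Q hs) z by apply: IH => u uhs; apply: sH; rewrite inE uhs orbT.
  apply: IH; split=> [|{}z /= Qz]; first exact: lspan_subspace.
  have /choice[c hc] : forall u, exists c, u \in hs -> lie u z = c *: z.
    move=> u; have [/Qz[c uz]|_] := boolP (u \in hs); last by exists 0.
    by exists c.
  pose E := [set y | forall u, u \in hs -> lie u y = c u *: y].
  have sE : is_subspace E.
    split=> [u _|k y y' Ey Ey' u uhs]; first by rewrite lie0r scaler0.
    by rewrite lieDr lieZr Ey // Ey' // scalerDr !scalerA mulrC.
  have stE (i : unit) y : E y -> E (lie g y).
    move=> Ey u uhs; have uH : u \in H by apply: sH; rewrite inE uhs orbT.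
    by rewrite lie_derivation (abH _ _ uH gH) lie0l add0r Ey // lieZr.
  have [s [w [us ww zE]]] := ad_decomposable (dgH g gH) z.
  have Ez : E (\sum_(t <- s) w t) by rewrite -zE; exact: hc.
  have sep (p q : F) : p != q -> exists i : unit, p != q by exists tt.
  rewrite zE big_seq; apply: subspace_sum; first exact: lspan_subspace.
  move=> t ts; apply: lspan_gen => u; rewrite inE => /orP[/eqP->|uhs].
    by exists t; exact: (ww t tt).
  exists (c u); exact: (component_mem sep sE stE us ww Ez ts).
have := QT (vbasis H) (fun u => @vbasis_mem _ _ u H) x; apply.
split=> [|{}x Qx]; first exact: decomposable_subspace.
have [->|x0] := eqVneq x 0; first exact: (decomposable_subspace _ _).1.
have [a xa] : exists a, W a x.
  apply: eigenvector_weight => // h.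
  have /choice[c hc] : forall i : 'I_(\dim H),
      exists c, lie (vbasis H)`_i x = c *: x.
    by move=> i; apply: Qx; rewrite mem_nth ?size_tuple.
  exists (\sum_i coord (vbasis H) i (vsval h) * c i).
  rewrite {1}(coord_vbasis (subvsP h)) lie_suml scaler_suml; apply: eq_bigr => i _.
  by rewrite lieZl hc scalerA.
exact: weight_vector_decomposable xa.
Qed.

Lemma root_space_ind (S : set L) : is_subspace S ->
  (forall x, x \in H -> S x) -> (forall a x, D a -> W a x -> S x) ->
  forall x, S x.
Proof.
move=> sS SH SD x; have [s [w [_ ww ->]]] := weight_decomposable x.
apply: subspace_sum => // a _.
have [->|a0] := eqVneq a 0; first exact/SH/weight_space0E/(ww 0).
have [->|wa0] := eqVneq (w a) 0; first exact: subspace0.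
by apply: (SD a) (ww a); split=> //; exists (w a) => //; exact: ww.
Qed.

(** Simplicity is stated for [{vspace L}], while [S] is a mere set. A subspace inside [S] is
    enlarged, starting from the line of [z], until it exhausts [S]; its codimension bounds the
    number of enlargements. *)
Lemma simple_ideal (S : set L) : is_subspace S ->
  (forall x y, S y -> S (lie x y)) -> (exists2 x, S x & x != 0) ->
  forall x, S x.
Proof.
move=> sS idS [z Sz z0].
have [n] := ubnP (\dim {:L} - \dim <[z]>)%N.
pose sub (U : {vspace L}) := forall x, x \in U -> S x.
have : sub <[z]>%VS by move=> u /vlineP[k ->]; exact: subspaceZ.
have : z \in <[z]>%VS by exact: memv_line.
elim: n <[z]>%VS => // n IH U zU SU.
have [SU'|] := pselect (exists2 x, S x & x \notin U).
  case: SU' => y Sy yU nU.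
  apply: (IH (U + <[y]>)%VS).
  - by apply: (subvP (addvSl U <[y]>)).
  - move=> u /memv_addP[u1 u1U [u2 /vlineP[k ->] ->]].
    by apply: subspaceD => //; [exact: SU | exact: subspaceZ].
  have dU : (\dim U < \dim (U + <[y]>))%N.
    rewrite (ltn_leqif (dimv_leqif_sup (addvSl _ _))).
    by apply: contra yU => /subvP; apply; apply: (subvP (addvSr U <[y]>)); exact: memv_line.
  have := dimvS (subvf (U + <[y]>)%VS); move: dU nU.
  move: (\dim _) (\dim _) (\dim _) => p q r pq; rewrite !ltnS => pr qr.
  apply: leq_trans pr; rewrite ltn_sub2l //; exact: leq_trans pq qr.
move=> nS _; have SE x : S x <-> x \in U.
  split=> [Sx|]; last exact: SU.
  by apply: contrapT => /negP xU; apply: nS; exists x.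
have [U0|UT] : U = 0%VS \/ U = fullv.
  by case: simpleL => _; apply=> x y /SE Sy; apply/SE/idS.
  by move: zU; rewrite U0 memv0 (negPf z0).
by move=> x; apply: SU; rewrite UT memvf.
Qed.

Lemma center_trivial x : (forall y, lie y x = 0) -> x = 0.
Proof.
move=> zx; apply: contrapT => /eqP x0.
have [[y [z yz]] _] := simpleL.
have := @simple_ideal [set u | forall v, lie v u = 0] _ _ _ z.
move=> /(_ _ _ _ y) E; move: yz; rewrite E ?eqxx //.
- split=> [v|k u u' zu zu' v]; first exact: lie0r.
  by rewrite lieDr lieZr zu zu' scaler0 addr0.
- by move=> u v zv w; rewrite zv lie0r.
- by exists x.
Qed.

(** Such an [x] commutes with [H] and with all root vectors, hence is central. *)
Lemma roots_separate x : x \in H -> (forall a, D a -> a (vsproj H x) = 0) -> x = 0.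
Proof.
move=> xH ax; apply: center_trivial => y; rewrite lieC.
suff -> : lie x y = 0 by rewrite oppr0.
move: y; apply: root_space_ind.
- split=> [|k u v xu xv]; first exact: lie0r.
  by rewrite lieDr lieZr xu xv scaler0 addr0.
- by move=> y yH; rewrite cartan_lie0.
- move=> a y Da wy; have := wy (vsproj H x).
  by rewrite vsprojK // ax // scale0r.
Qed.

Lemma root_exists : exists a, D a.
Proof.
apply: contrapT => nD; have [[x [y xy]] _] := simpleL.
have LH z : z \in H.
  move: z; apply: root_space_ind => //[|a x' Da]; last by case: nD; exists a.
  by split=> [|k u v uH vH]; rewrite ?mem0v ?memvD ?memvZ.
by rewrite cartan_lie0 ?eqxx in xy.
Qed.

Lemma weight_space_iter a b x y k : W a x -> W b y ->
  W (b + a *+ k) (iter k (lie x) y).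
Proof.
move=> wx wy; elim: k => [|k IH]; first by rewrite addr0.
by rewrite mulrS addrCA; exact: weight_space_lie.
Qed.

Lemma nonzero_root a x : a != 0 -> W a x -> x != 0 -> D a.
Proof. by move=> a0 wx x0; split=> //; exists x. Qed.

Lemma root_vector a : D a -> exists2 x, W a x & x != 0.
Proof. by case. Qed.

Lemma root_nz a : D a -> a != 0. Proof. by case. Qed.

Lemma dual_mulrnE a k h : ((a *+ k) h : F) = k%:R * (a h : F).
Proof.
elim: k => [|k IH]; first by rewrite mul0r lfunE.
by rewrite mulrS add_lfunE IH -nat1r mulrDl mul1r.
Qed.

(** Choose [h] with [a h != 0]. If no iterate vanished, [h] would have the infinitely many distinct
    eigenvalues [b h + k (a h)]. *)
Lemma ad_locally_nilpotent a b x y : a != 0 -> W a x -> W b y ->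
  exists n, iter n (lie x) y = 0.
Proof.
move=> /dual_nz[h ah] wx wy; apply: contrapT => nz.
have [s hs] : exists s : seq F,
    forall c z, z != 0 -> lie (vsval h) z = c *: z -> c \in s.
  by apply: ad_finite_spectrum; case: cartanH => _ + _; apply; exact: subvsP.
pose f k : F := b h + k%:R * (a h : F).
have fs k : f k \in s.
  apply: (hs _ (iter k (lie x) y)); first by apply/eqP => it0; apply: nz; exists k.
  by rewrite (weight_space_iter k wx wy) add_lfunE dual_mulrnE.
have finj : injective f.
  by move=> p q /addrI/(mulIf ah)/eqP; rewrite eqr_nat => /eqP.
suff : (size (map f (iota 0 (size s).+1)) <= size s)%N.
  by rewrite size_map size_iota ltnn.
apply: uniq_leq_size; first by rewrite map_inj_uniq ?iota_uniq.
by move=> _ /mapP[k _ ->].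
Qed.

Lemma raise_to_top a b x y : a != 0 -> W a x -> W b y -> y != 0 ->
  exists k, iter k (lie x) y != 0 /\ lie x (iter k (lie x) y) = 0.
Proof.
move=> a0 wx wy y0; have ex : exists n, iter n (lie x) y == 0.
  by have [n yn] := ad_locally_nilpotent a0 wx wy; exists n; apply/eqP.
case: (ex_minnP ex) => -[|n] /= yn minn; first by rewrite (negPf y0) in yn.
exists n; split; last exact/eqP.
by apply/negP => /minn; rewrite ltnn.
Qed.

(** * Orthogonality and duality of weight spaces *)

Lemma formZr c x y : kappa x (c *: y) = c * kappa x y.
Proof. by rewrite form_sym formZl form_sym. Qed.

Lemma form0r x : kappa x 0 = 0.
Proof. by rewrite form_sym form0l. Qed.

Lemma form_orthogonal_subspace (S : set L) :
  is_subspace [set x | forall y, S y -> kappa x y = 0].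
Proof.
split=> [y _|c x x' Sx Sx' y Sy]; first exact: form0l.
by rewrite formDl formZl Sx // Sx' // mulr0 addr0.
Qed.

Lemma form_orthogonal a b x y : W a x -> W b y -> a + b != 0 -> kappa x y = 0.
Proof.
move=> wx wy /dual_nz[h]; rewrite add_lfunE => abh.
apply/eqP; have : ((a h : F) + b h) * kappa x y = 0.
  rewrite mulrDl -formZl -formZr -wx -wy -form_invariant -formDl.
  by rewrite (lieC x) addrN form0l.
by move/eqP; rewrite mulf_eq0 (negPf abh).
Qed.

(** Only components of weight [- a] can pair nontrivially with [x], so nondegeneracy provides one.
    For [a = 0] this is nondegeneracy on [H]. *)
Lemma form_dual_vector a x : W a x -> x != 0 ->
  exists2 y, W (- a) y & kappa x y = 1.
Proof.
move=> wx x0; apply: contrapT => nodual.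
have k0 y : W (- a) y -> kappa x y = 0.
  move=> wy; apply/eqP/negPn/negP => xy; apply: nodual.
  by exists ((kappa x y)^-1 *: y); [exact: weight_spaceZ | rewrite formZr mulVf].
move/eqP: x0; apply; apply: (@form_nondegenerate _ _ kappa) => y.
have [s [w [_ ww ->]]] := weight_decomposable y.
rewrite form_sym.
apply: (subspace_sum (S := [set y | forall z, [set x] z -> kappa y z = 0])) => //.
  exact: form_orthogonal_subspace.
move=> b _ _ ->; rewrite form_sym; have [ab|] := eqVneq (a + b) 0.
  apply: k0; suff -> : - a = b by exact: ww.
  by apply/esym/eqP; rewrite -addr_eq0 addrC ab.
by move=> ab; apply: form_orthogonal ab; [exact: wx | exact: ww].
Qed.

Lemma root_opp a : D a -> D (- a).
Proof.
move=> [a0 [x wx x0]]; have [y wy xy] := form_dual_vector wx x0.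
apply: nonzero_root wy _; first by rewrite oppr_eq0.
by apply: contra_eq_neq xy => ->; rewrite form0r eq_sym oner_eq0.
Qed.

Lemma lie_opp_weight a x y : W a x -> W (- a) y -> lie x y \in H.
Proof. by move=> wx wy; apply/weight_space0E; rewrite -(subrr a); exact: weight_space_lie. Qed.

Lemma form_lie_cartan a x y h : W a x -> W (- a) y ->
  kappa (lie x y) (vsval h) = (a h : F) * kappa x y.
Proof.
by move=> wx wy; rewrite form_invariant lieC wy opp_lfunE scaleNr opprK formZr.
Qed.

(** By [form_lie_cartan], [[x, y]] is an element of [H] orthogonal to [H]. *)
Lemma lie_opp_weight_eq0 a x y : W a x -> W (- a) y -> kappa x y = 0 -> lie x y = 0.
Proof.
move=> wx wy xy; apply/eqP/negPn/negP => nz.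
have w0 : W 0 (lie x y) by apply/weight_space0E/(lie_opp_weight wx wy).
have [z] := form_dual_vector w0 nz; rewrite oppr0 => /weight_space0E zH.
rewrite -(vsprojK zH) (form_lie_cartan _ wx wy) xy mulr0 => /eqP.
by rewrite eq_sym oner_eq0.
Qed.

(* If a vanishes at t := [x, y], then x, y, t span a Heisenberg algebra, whose
   central element acts by 0 on every finite-dimensional weight string. *)
Lemma root_coroot_nz a x y : D a -> W a x -> W (- a) y -> kappa x y = 1 ->
  (a (vsproj H (lie x y)) : F) != 0.
Proof.
move=> Da wx wy xy1; set h := vsproj H _.
have hE : vsval h = lie x y by apply: vsprojK; exact: lie_opp_weight wx wy.
apply/negP => /eqP ah0; have a0 := root_nz Da.
have bh b : D b -> b h = 0.
  move=> [b0 [v wv v0]]; apply/eqP/negPn/negP => bh0.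
  have [k [top0 top]] := raise_to_top a0 wx wv v0.
  set v' := iter k _ _ in top0 top.
  have wv' : W (b + a *+ k) v' by exact: weight_space_iter.
  have na0 : - a != 0 by rewrite oppr_eq0.
  have [n] := ad_locally_nilpotent na0 wy wv'.
  apply/eqP; apply: (@ladder_nz _ _ x y v' (fun=> b h) top) => // [j|j _].
    rewrite -hE (weight_space_iter j wy wv') !add_lfunE !dual_mulrnE.
    by rewrite opp_lfunE ah0 oppr0 !mulr0 !addr0.
  by rewrite sumr_const card_ord -mulr_natl mulf_neq0 // pnatr_eq0.
(* All roots vanish on [h], so [h = 0]; then [form_lie_cartan] with [kappa x y = 1] gives
   [a = 0]. *)
have : lie x y = 0.
  by rewrite -hE; apply: roots_separate; [exact: subvsP | move=> b /bh; rewrite vsvalK].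
move=> xy0; move: a0; apply/negP/negPn/eqP/lfunP => h'.
have := form_lie_cartan h' wx wy; rewrite xy0 form0l xy1 mulr1 => <-.
by rewrite lfunE.
Qed.

(** * Triples of type sl2 and root strings *)

Definition sl2_triple a (e f : L) h : Prop :=
  [/\ W a e, W (- a) f, lie e f = vsval h & (a h : F) = 2%:R].

Lemma sl2_triple_exists a e : D a -> W a e -> e != 0 ->
  exists f h, sl2_triple a e f h.
Proof.
move=> Da we e0; have [y wy ey1] := form_dual_vector we e0.
have := root_coroot_nz Da we wy ey1; set t := vsproj H _ => at0.
have tE : vsval t = lie e y by apply: vsprojK; exact: lie_opp_weight we wy.
exists ((2%:R / (a t : F)) *: y), ((2%:R / (a t : F)) *: t); split=> //.
- exact: weight_spaceZ.
- by rewrite lieZr linearZ /= tE.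
- by rewrite linearZ /= -[_ *: _]/(_ * _) divfK.
Qed.

Lemma sl2_triple_sym a e f h : sl2_triple a e f h -> sl2_triple (- a) f e (- h).
Proof.
move=> [we wf ef ah]; split=> //; first by rewrite opprK.
  by rewrite lieC ef linearN.
by rewrite opp_lfunE linearN opprK.
Qed.

Lemma sl2_triple_root_nz a e f h : sl2_triple a e f h -> a != 0.
Proof.
move=> [_ _ _ ah]; apply: contra_eq_neq ah => ->.
by rewrite lfunE eq_sym pnatr_eq0.
Qed.

(** The coefficients of [ladder] are [(k + 1)(b h - k)]. If [b h] were not a natural number, none
    would vanish, against the nilpotency of [f]. *)
Lemma sl2_highest_weight a e f h b v : sl2_triple a e f h ->
  W b v -> v != 0 -> lie e v = 0 ->
  exists M : nat, [/\ (b h : F) = M%:R,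
    forall k, (k <= M)%N -> iter k (lie f) v != 0 &
    forall k, lie e (iter k.+1 (lie f) v) =
      (k.+1%:R * (M%:R - k%:R)) *: iter k (lie f) v].
Proof.
move=> sl2; have a0 := sl2_triple_root_nz sl2; have [we wf ef ah] := sl2.
move=> wv v0 ev.
have hv k : lie (lie e f) (iter k (lie f) v) =
    ((b h : F) - 2%:R * k%:R) *: iter k (lie f) v.
  rewrite ef (weight_space_iter k wf wv) add_lfunE dual_mulrnE opp_lfunE ah.
  by rewrite mulrN mulrC.
have sumE k : \sum_(j < k.+1) ((b h : F) - 2%:R * j%:R) =
    k.+1%:R * ((b h : F) - k%:R).
  elim: k => [|k IH]; first by rewrite big_ord_recl big_ord0 /= mulr0 !subr0 addr0 mul1r.
  by rewrite big_ord_recr /= IH -!natr1; ring.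
have [M bM] : exists M : nat, (b h : F) = M%:R.
  apply: contrapT => nM.
  have na0 : - a != 0 by rewrite oppr_eq0.
  have [n] := ad_locally_nilpotent na0 wf wv; apply/eqP.
  apply: (ladder_nz ev hv) => // k _.
  rewrite sumE mulf_neq0 ?pnatr_eq0 // subr_eq0; apply/eqP => bk.
  by apply: nM; exists k.
exists M; split=> // [k kM|k].
  apply: (ladder_nz ev hv) => // j jk; rewrite sumE mulf_neq0 ?pnatr_eq0 //.
  by rewrite bM subr_eq0 eqr_nat; apply: contraTneq jk => <-; rewrite -leqNgt.
by rewrite (ladder ev hv) sumE bM.
Qed.

(** Modulo [e], the vector [x] is orthogonal to [f], hence commutes with it. A nonzero remainder
    would be a highest weight vector of weight -2 for the opposite triple, but highest weights are
    natural numbers. *)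
Lemma root_space_line a e x : D a -> W a e -> e != 0 -> W a x ->
  exists c, x = c *: e.
Proof.
move=> Da we e0 wx; have [f [h sl2]] := sl2_triple_exists Da we e0.
have [_ wf ef ah] := sl2.
have ef0 : kappa e f != 0.
  apply/negP => /eqP ef0; have := lie_opp_weight_eq0 we wf ef0; rewrite ef => h0.
  have hz : h = 0 by rewrite -[h]vsvalK h0 linear0.
  by move/eqP: ah; rewrite hz linear0 eq_sym pnatr_eq0.
pose c := kappa x f / kappa e f; exists c; apply/eqP; rewrite -subr_eq0.
apply/negPn/negP => x'0; set x' := x - _ in x'0.
have wx' : W a x' by exact: (subspaceB (weight_space_subspace a) wx (weight_spaceZ c we)).
have fx' : lie f x' = 0.
  rewrite lieC (lie_opp_weight_eq0 wx' wf) ?oppr0 //.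
  by rewrite /x' -scaleNr formDl formZl mulNr divfK // subrr.
have [M [aM _ _]] := sl2_highest_weight (sl2_triple_sym sl2) wx' x'0 fx'.
move: aM; rewrite linearN /= ah => /eqP.
by rewrite eqr_oppLR -addr_eq0 -natrD pnatr_eq0.
Qed.

(** If [[x, y] = 0], then [y] has highest weight [m], and raising [z] by [k] steps gives a highest
    weight vector [w] of weight [m + 2k + 2]. Lowering [w] by [k + 1] steps lands on the line of
    [y], which [x] kills; but [x] sends the result to a nonzero multiple of the previous vector. *)
Lemma lie_root_vectors_nz a b x y : D a -> D b -> D (a + b) ->
  W a x -> x != 0 -> W b y -> y != 0 -> lie x y != 0.
Proof.
move=> Da Db [_ [z wz z0]] wx x0 wy y0; apply/negP => /eqP xy.
have [f [h sl2]] := sl2_triple_exists Da wx x0.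
have [_ wf _ ah] := sl2.
have [m [bm _ _]] := sl2_highest_weight sl2 wy y0 xy.
have [k [w0 xw]] := raise_to_top (root_nz Da) wx wz z0.
have := weight_space_iter k wx wz; set w := iter k _ _ in w0 xw * => ww.
have [M [bM fw0 xfw]] := sl2_highest_weight sl2 ww w0 xw.
have ME : M = (m + k.*2.+2)%N.
  apply/eqP; rewrite -(eqr_nat F) -bM !add_lfunE dual_mulrnE ah bm.
  by rewrite -doubleS -mul2n natrD natrM -natr1; apply/eqP; ring.
have wu : W b (iter k.+1 (lie f) w).
  have := weight_space_iter k.+1 wf ww; congr (W _ _).
  by rewrite mulNrn mulrS opprD addrACA subrr addr0 addrAC subrr add0r.
have [c uE] := root_space_line Db wy y0 wu.
have := xfw k; rewrite uE lieZr xy scaler0 => /esym/eqP.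
rewrite scaler_eq0 mulf_eq0 pnatr_eq0 /= subr_eq0 eqr_nat.
rewrite (negPf (fw0 k _)) ?orbF.
  by rewrite ME => /eqP; lia.
by rewrite ME; lia.
Qed.

(** Raise [v] by [k] steps to a highest weight vector [w], of weight [M = m + 2k]. As root spaces
    are lines, [f^k w] is a multiple of [v], so [f^m v = 0] would give [f^(m + k) w = 0] although
    [m + k <= M]. *)
Lemma sl2_lowering a e f h b v : sl2_triple a e f h -> D b -> W b v -> v != 0 ->
  exists2 m : int, (b h : F) = m%:~R &
    (0 <= m -> iter `|m|%N (lie f) v != 0).
Proof.
move=> sl2 Db wv v0; have [we wf _ ah] := sl2.
have [k [w0 ew]] := raise_to_top (sl2_triple_root_nz sl2) we wv v0.
have := weight_space_iter k we wv; set w := iter k _ _ in w0 ew * => ww.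
have [M [bM fw0 _]] := sl2_highest_weight sl2 ww w0 ew.
exists (M%:Z - k.*2%:Z).
  rewrite intrB -!pmulrn -bM add_lfunE dual_mulrnE ah -mul2n natrM; ring.
move=> m0; apply/negP => /eqP fv.
have wu : W b (iter k (lie f) w).
  have := weight_space_iter k wf ww; congr (W _ _).
  by rewrite mulNrn addrK.
have [c uE] := root_space_line Db wv v0 wu.
have iterZ n u : iter n (lie f) (c *: u) = c *: iter n (lie f) u.
  by elim: n => //= n ->; rewrite lieZr.
have := fw0 (`|M%:Z - k.*2%:Z| + k)%N; rewrite iterD uE iterZ fv scaler0 eqxx.
by move=> /(_ _)/negP; apply => //; lia.
Qed.

Lemma sl2_string a e f h b v : sl2_triple a e f h -> D b -> W b v -> v != 0 ->
  exists m : int, [/\ (b h : F) = m%:~R,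
    0 <= m -> iter `|m|%N (lie f) v != 0 &
    m <= 0 -> iter `|m|%N (lie e) v != 0].
Proof.
move=> sl2 Db wv v0; have [m bm fv] := sl2_lowering sl2 Db wv v0.
have [m' bm' ev] := sl2_lowering (sl2_triple_sym sl2) Db wv v0.
have mE : m' = - m.
  by apply/eqP; rewrite -(eqr_int F) -bm' intrN -bm linearN.
exists m; split=> // m0; rewrite -(abszN m) -mE.
by apply: ev; rewrite mE oppr_ge0.
Qed.

(** The reflected weight is reached from [b] by [|m|] applications of [f] or [e], according to the
    sign of [m]. *)
Lemma sl2_reflection a e f h b : sl2_triple a e f h -> D b ->
  exists2 m : int, (b h : F) = m%:~R & D (b - m%:~R *: a).
Proof.
move=> sl2 Db; have [v wv v0] := root_vector Db; have [we wf _ ah] := sl2.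
have [m [bm fv ev]] := sl2_string sl2 Db wv v0; exists m => //.
(* If it were 0, evaluation at [h] would give [m - 2m = 0], and so [b = 0]. *)
have nz : b - m%:~R *: a != 0.
  apply: contra_neq (root_nz Db) => bma; have : ((b - (m%:~R : F) *: a) h : F) = 0.
    by rewrite bma lfunE.
  rewrite add_lfunE opp_lfunE scale_lfunE bm ah -[_ *: _]/(_ * _) => m0.
  have m0' : m%:~R = 0 :> F by rewrite -[RHS]oppr0 -m0; ring.
  by move: bma; rewrite m0' scale0r subr0.
have [m0|m0] := leP 0 m.
  apply: (nonzero_root nz _ (fv m0)); have := weight_space_iter `|m|%N wf wv.
  by congr (W _ _); rewrite mulNrn -scaler_nat pmulrn gez0_abs.
apply: (nonzero_root nz _ (ev (ltW m0))); have := weight_space_iter `|m|%N we wv.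
by congr (W _ _); rewrite -scaler_nat pmulrn ltz0_abs // intrN scaleNr.
Qed.

Lemma sl2_moves a e f h b v : sl2_triple a e f h -> W b v -> v != 0 ->
  (b h : F) != 0 -> lie e v != 0 \/ lie f v != 0.
Proof.
move=> [_ _ ef _] wv v0 bh; have [ev|] := eqVneq (lie e v) 0; last by left.
right; apply: contra_neq bh => fv; have := wv h.
rewrite -ef => /eqP; have := lie_derivation e f v.
rewrite ev fv !lie0r addr0 => <-; rewrite eq_sym scaler_eq0 (negPf v0) orbF.
by move/eqP.
Qed.

(* The root spaces of T together with their brackets with the opposite root
   spaces span an ideal. *)
Lemma roots_irreducible (T : set dual) : T `<=` D -> T !=set0 ->
  (forall a, T a -> T (- a)) ->
  (forall a b, T a -> D b -> D (a + b) -> T (a + b)) -> D `<=` T.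
Proof.
move=> TD [a0 Ta0] TN TDD.
pose G := [set z | (exists2 a, T a & W a z) \/
  exists a x y, [/\ T a, W a x, W (- a) y & z = lie x y]].
have sI := lspan_subspace G.
have IW a x : T a -> W a x -> lspan G x.
  by move=> Ta wx; apply: lspan_gen; left; exists a.
(* Root vectors outside [T] commute with those in [T]: a nonzero bracket would put [a + b], and then
   [b], in [T]. *)
have vanish b a u x : ~ T b -> D b -> W b u -> T a -> W a x -> lie u x = 0.
  move=> nTb Db wu Ta wx; apply/eqP/negPn/negP => ux; apply: nTb.
  have [ab0|ab0] := eqVneq (a + b) 0.
    by rewrite (_ : b = - a); [exact: TN | apply/eqP; rewrite -addr_eq0 addrC ab0].
  have Tab : T (a + b).
    apply: TDD => //; apply: nonzero_root ux => //; rewrite addrC.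
    exact: weight_space_lie.
  have bE : a + b - a = b by rewrite addrC addKr.
  by rewrite -bE; apply: TDD; rewrite ?bE //; exact/root_opp/TD.
have idI u z : lspan G z -> lspan G (lie u z).
  move: u; suff GI u : (lspan G `<=` [set z | lspan G (lie u z)]) by move=> u; exact: GI.
  move: u; apply: root_space_ind => [|u uH|b u Db wu].
  - split=> [v _|c u v Iu Iv w Iw]; first by rewrite /= lie0l; exact: subspace0.
    by rewrite /= lieDl lieZl; apply: sI.2; [exact: Iu | exact: Iv].
  - apply: lspan_min => [|v [[a Ta wv]|[a [x [y [Ta wx wy ->]]]]]].
    + split=> [|c v w Iv Iw]; first by rewrite /= lie0r; exact: subspace0.
      by rewrite /= lieDr lieZr; exact: sI.2.
    + by apply: (IW a) => //; rewrite -[a]add0r; apply: weight_space_lie => //; exact/weight_space0E.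
    + rewrite /= cartan_lie0 //; first exact: subspace0.
      exact: lie_opp_weight wx wy.
  - apply: lspan_min => [|v [[a Ta wv]|[a [x [y [Ta wx wy ->]]]]]].
    + split=> [|c v w Iv Iw]; first by rewrite /= lie0r; exact: subspace0.
      by rewrite /= lieDr lieZr; exact: sI.2.
    + have [Tb|nTb] := pselect (T b); last first.
        by rewrite /= (vanish b a) //; exact: subspace0.
      have [uv|uv] := eqVneq (lie u v) 0; first by rewrite /= uv; exact: subspace0.
      have [ab0|ab0] := eqVneq (a + b) 0.
        apply: lspan_gen; right; exists b, u, v; split=> //.
        by rewrite (_ : - b = a) //; apply/eqP; rewrite eq_sym -addr_eq0 ab0.
      have wuv : W (a + b) (lie u v) by rewrite addrC; exact: weight_space_lie.
      by apply: (IW (a + b)) => //; apply: TDD => //; exact: nonzero_root uv.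
    + have [Tb|nTb] := pselect (T b).
        apply: (IW b) => //; rewrite -[b]addr0 -(subrr a).
        by apply: weight_space_lie => //; exact: weight_space_lie.
      rewrite /= lie_derivation (vanish b a u x) // (vanish b (- a) u y) //; last exact: TN.
      by rewrite lie0l lie0r addr0; exact: subspace0.
have IL x : lspan G x.
  apply: simple_ideal => //; have [x0 wx0 x00] := root_vector (TD _ Ta0).
  by exists x0 => //; exact: IW wx0.
(* The ideal is everything, yet for a root [b] outside [T] it is orthogonal to the root space of
   [- b]. *)
move=> b Db; apply: contrapT => nTb; have [v wv v0] := root_vector Db.
have [y wy vy] := form_dual_vector wv v0.
suff /(_ _ (IL v) y wy)/eqP : lspan G `<=` [set u | forall y, W (- b) y -> kappa u y = 0].
  by rewrite vy oner_eq0.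
apply: lspan_min => [|u [[a Ta wu]|[a [x [z [Ta wx wz ->]]]]] w ww].
- exact: form_orthogonal_subspace.
- apply: form_orthogonal wu ww _; rewrite subr_eq0.
  by apply: contra_not_neq nTb => <-.
- have w0 : W 0 (lie x z) by rewrite -(subrr a); exact: weight_space_lie.
  by apply: form_orthogonal w0 ww _; rewrite add0r oppr_eq0; exact: root_nz.
Qed.

(** In rank at least two [a] has a nonzero kernel, on which every root would vanish if [a] and [- a]
    were the only ones. *)
Lemma third_root a : (1 < \dim H)%N -> exists b, [/\ D b, b != a & b != - a].
Proof.
move=> rk; apply: contrapT => nb.
have k0 : lker a != 0%VS.
  rewrite -dimv_eq0; apply: contraTneq rk => k0; rewrite -leqNgt.
  have := limg_ker_dim a fullv; rewrite capfv k0 add0n dimvf => E.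
  rewrite (_ : \dim H = \dim (a @: fullv)); last by rewrite E.
  by apply: leq_trans (dimvS (subvf _)) _; rewrite dimvf.
have v0 : vpick (lker a) != 0 by rewrite vpick0.
have := memv_pick (lker a); rewrite memv_ker => /eqP av.
move/eqP: v0; apply; rewrite -[LHS]vsvalK (_ : vsval _ = 0) ?linear0 //.
apply: roots_separate => [|b Db]; first exact: subvsP.
rewrite vsvalK; have [->//|ba] := eqVneq b a.
have [->|bNa] := eqVneq b (- a); first by rewrite opp_lfunE av oppr0.
by case: nb; exists b.
Qed.

(** * Weights and roots of the affine algebra *)

Local Notation affine := (affine_algebra kappa).
Local Notation adual := (affine_dual H).
Local Notation iota := (affine_cartan_incl kappa H).
Local Notation AW := (weight_space (affine_cartan_incl kappa H)).

Definition loop_vector (r : int) (x : L) : affine := (monomial r x, 0, 0).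
(** The value [a = 0] is allowed and gives the multiples of [delta], so imaginary roots share the
    notation. *)
Definition affine_root (a : dual) (r : int) : adual :=
  ext_root a + r%:~R *: delta H.

Lemma affine_rootE a r (h : affine_cartan H) :
  (affine_root a r h : F) = (a h.1.1 : F) + r%:~R * h.2.
Proof. by rewrite add_lfunE ext_rootE scale_lfunE deltaE. Qed.

Lemma affine_root_inj a b r s : affine_root a r = affine_root b s -> a = b /\ r = s.
Proof.
move=> E; have Eh (h : affine_cartan H) :
    (a h.1.1 : F) + r%:~R * h.2 = (b h.1.1 : F) + s%:~R * h.2.
  by rewrite -!affine_rootE E.
split; last first.
  apply/eqP; rewrite -(eqr_int F); apply/eqP.
  by have := Eh (0, 0, 1); rewrite /= !linear0 !add0r !mulr1.
apply/lfunP => h; have := Eh (h, 0, 0).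
by rewrite /= !mulr0 !addr0.
Qed.

Lemma affine_rootD a b r s :
  affine_root a r + affine_root b s = affine_root (a + b) (r + s).
Proof.
apply/lfunP => h; rewrite add_lfunE !affine_rootE add_lfunE intrD mulrDl.
exact: addrACA.
Qed.

Lemma affine_rootN a r : - affine_root a r = affine_root (- a) (- r).
Proof.
apply/lfunP => h; rewrite opp_lfunE !affine_rootE opp_lfunE intrN mulNr.
exact: opprD.
Qed.

Lemma affine_rootMz a r (m : int) :
  m%:~R *: affine_root a r = affine_root (m%:~R *: a) (m * r).
Proof.
apply/lfunP => h; rewrite scale_lfunE !affine_rootE scale_lfunE intrM -mulrA.
exact: scalerDr.
Qed.

Lemma real_roots_affine a r : real_roots H (affine_root a r) <-> D a.
Proof.
split=> [[b [s [Db /affine_root_inj[-> _]]]] //|Da].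
by exists a, r.
Qed.

Lemma loop_vector_linear r c x y :
  loop_vector r (c *: x + y) = c *: loop_vector r x + loop_vector r y.
Proof.
apply: affineP => /=; try by rewrite scaler0 addr0.
apply/loopP => n; rewrite loopDE loopZE /=.
by case: eqP => // _; rewrite scaler0 addr0.
Qed.

Lemma loop_vector0 r : loop_vector r 0 = 0.
Proof. by apply: affineP => //=; rewrite monomial0. Qed.

Lemma loop_vectorZ r c x : loop_vector r (c *: x) = c *: loop_vector r x.
Proof. by have := loop_vector_linear r c x 0; rewrite loop_vector0 !addr0. Qed.

Lemma monomial_eq0 r x : monomial r x = 0 -> x = 0.
Proof. by move/loopP/(_ r); rewrite /= eqxx. Qed.

Lemma loop_vector_nz r x : x != 0 -> loop_vector r x != 0.
Proof. by apply: contra_neq => /(congr1 (fun u => u.1.1)) /= /monomial_eq0. Qed.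

Lemma loop_br_monomial0 x (f : loop L) n : loop_br (monomial 0 x) f n = lie x (f n).
Proof.
rewrite /= (@loop_br_funE _ _ _ _ [fset 0]%fset); last first.
  by move=> i; rewrite in_fset1 /= => /negPf ->.
by rewrite big_seq_fset1 /= subr0.
Qed.

Lemma loop_cocycle_monomial0 x (f : loop L) : loop_cocycle kappa (monomial 0 x) f = 0.
Proof.
rewrite (@loop_cocycleE _ _ _ _ _ [fset 0]%fset); last first.
  by move=> i; rewrite in_fset1 /= => /negPf ->.
by rewrite big_seq_fset1 mul0r.
Qed.

Lemma loop_deg_monomial0 x : loop_deg (monomial 0 x) = 0 :> loop L.
Proof.
apply/loopP => n /=; case: eqP => [->|_]; last by rewrite scaler0.
by rewrite scale0r.
Qed.

Lemma lie_cartanE (h : affine_cartan H) (u : affine) : [/\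
  forall n, (lie (iota h) u).1.1 n =
    lie (vsval h.1.1) (u.1.1 n) + ((n%:~R : F) * h.2) *: u.1.1 n,
  (lie (iota h) u).1.2 = 0 & (lie (iota h) u).2 = 0].
Proof.
split=> [n||//]; last exact: loop_cocycle_monomial0.
change ((loop_br (monomial 0 (vsval h.1.1)) u.1.1 + (h.2 : F) *: loop_deg u.1.1 -
  (u.2 : F) *: loop_deg (monomial 0 (vsval h.1.1))) n =
  lie (vsval h.1.1) (u.1.1 n) + ((n%:~R : F) * h.2) *: u.1.1 n).
rewrite loop_deg_monomial0 scaler0 subr0 loopDE loopZE.
by rewrite loop_br_monomial0 /= scalerA mulrC.
Qed.

Lemma lie_loop_vector r s x y :
  lie (loop_vector r x) (loop_vector s y) = (monomial (r + s) (lie x y),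
    if r + s == 0 then r%:~R * kappa x y else 0, 0) :> affine.
Proof.
apply: affineP => //=; last exact: loop_cocycle_monomial.
by rewrite !scale0r addr0 subr0 loop_br_monomial.
Qed.

Lemma affine_weight_loop_vector a r x : W a x -> AW (affine_root a r) (loop_vector r x).
Proof.
move=> wx h; have [E1 E2 E3] := lie_cartanE h (loop_vector r x).
apply: affineP; rewrite ?E2 ?E3 /=; try by rewrite scaler0.
apply/loopP => n; rewrite E1 loopZE affine_rootE /=.
case: eqP => [->|_]; last by rewrite lie0r !scaler0 addr0.
by rewrite wx -scalerDl.
Qed.

Lemma affine_weight_cartan (h : affine_cartan H) : AW 0 (iota h).
Proof.
move=> h'; have [E1 E2 E3] := lie_cartanE h' (iota h).
rewrite lfunE /= scale0r; apply: affineP; rewrite ?E2 ?E3 //=.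
apply/loopP => n; rewrite E1 loop0E /=; case: eqP => [->|_].
  by rewrite mul0r scale0r addr0 cartan_lie0 ?subvsP.
by rewrite lie0r scaler0 addr0.
Qed.

Lemma affine_dual_sep (l m : adual) : l != m -> exists h : affine_cartan H, (l h : F) != m h.
Proof.
move=> lm; apply: contrapT => nh; move/eqP: lm; apply; apply/lfunP => h.
by apply: contrapT => /eqP lmh; apply: nh; exists h.
Qed.

(** Brackets with Cartan elements have no c and no d component, so a nonzero weight forces both
    coordinates of [u] to vanish; the action of d then singles out one power of t. *)
Lemma affine_weight_nz (l : adual) u : AW l u -> l != 0 -> u != 0 ->
  exists a r x, [/\ l = affine_root a r, u = loop_vector r x, W a x & x != 0].
Proof.
move=> wu l0 u0; have [h0 lh0] := affine_dual_sep l0; rewrite lfunE in lh0.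
have u12 : u.1.2 = 0.
  have [_ E _] := lie_cartanE h0 u; move: E; rewrite (wu h0) /= => /eqP.
  by rewrite scaler_eq0 (negPf lh0) => /eqP.
have u2 : u.2 = 0.
  have [_ _ E] := lie_cartanE h0 u; move: E; rewrite (wu h0) /= => /eqP.
  by rewrite scaler_eq0 (negPf lh0) => /eqP.
have wun (h : affine_cartan H) n :
    lie (vsval h.1.1) (u.1.1 n) + ((n%:~R : F) * h.2) *: u.1.1 n = (l h : F) *: u.1.1 n.
  by have [<- _ _] := lie_cartanE h u; rewrite wu.
have [r ur] : exists r, u.1.1 r != 0.
  apply: contrapT => nu; move/eqP: u0; apply; apply: affineP => //.
  apply/loopP => n; apply/eqP/negPn/negP => un; apply: nu.
  by exists n.
have [a wa] : exists a, W a (u.1.1 r).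
  apply: eigenvector_weight => // h; exists (l (h, 0, 0)).
  by rewrite -wun /= mulr0 scale0r addr0.
have lE : l = affine_root a r.
  apply/lfunP => h; apply/eqP; rewrite -subr_eq0; apply/eqP.
  have /eqP := wun h r; rewrite wa -scalerDl -affine_rootE -subr_eq0 -scalerBl.
  by rewrite scaler_eq0 (negPf ur) orbF subr_eq0 => /eqP ->; rewrite subrr.
exists a, r, (u.1.1 r); split=> //; apply: affineP => //=.
apply/loopP => n /=; case: eqP => [->//|/eqP nr].
have := wun (0, 0, 1) n; rewrite lE affine_rootE /= lie0l (linear0 a) !add0r !mulr1.
move/eqP; rewrite -subr_eq0 -scalerBl scaler_eq0 subr_eq0 eqr_int (negPf nr).
by move/eqP.
Qed.

Lemma affine_weight_rootE a r u : affine_root a r != 0 -> AW (affine_root a r) u ->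
  exists2 x, u = loop_vector r x & W a x.
Proof.
move=> ar0 wu; have [->|u0] := eqVneq u 0.
  by exists 0; [rewrite loop_vector0 | exact: weight_space0].
have [b [s [x [E uE wx x0]]]] := affine_weight_nz wu ar0 u0.
by have [ab rs] := affine_root_inj E; exists x; rewrite ?rs ?ab.
Qed.

Lemma affine_weight0 u : AW 0 u -> exists h : affine_cartan H, u = iota h.
Proof.
move=> wu.
have wun (h : affine_cartan H) n :
    lie (vsval h.1.1) (u.1.1 n) + ((n%:~R : F) * h.2) *: u.1.1 n = 0.
  by have [<- _ _] := lie_cartanE h u; rewrite wu lfunE /= scale0r.
have uH : u.1.1 0 \in H.
  apply/weight_space0E => h; have := wun (h, 0, 0) 0.
  by rewrite /= mulr0 scale0r addr0 lfunE /= scale0r.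
exists (vsproj H (u.1.1 0), u.1.2, u.2); apply: affineP => //=.
rewrite vsprojK //; apply/loopP => n /=; case: eqP => [->//|/eqP n0].
have := wun (0, 0, 1) n; rewrite /= lie0l add0r mulr1 => /eqP.
by rewrite scaler_eq0 intr_eq0 (negPf n0) => /eqP.
Qed.

Lemma affine_decomposable (u : affine) :
  decomposable iota (fun (l : adual) (h : affine_cartan H) => l h : F) u.
Proof.
have sD := @decomposable_subspace _ _ _ iota _
  (fun (l : adual) (h : affine_cartan H) => l h : F).
have -> : u = (u.1.1, 0, 0) + (0, u.1.2, u.2).
  by apply: affineP; rewrite /= ?addr0 ?add0r.
apply: (subspaceD sD); last first.
  apply: (weight_vector_decomposable (t := 0)).
  rewrite (_ : (0, _, _) = iota (0, u.1.2, u.2)); first exact: affine_weight_cartan.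
  by apply: affineP => //=; rewrite monomial0.
elim/loop_ind: u.1.1 => [|f g Df Dg|m x]; first exact: sD.1.
  rewrite (_ : (_, _, _) = ((f, 0, 0) : affine) + (g, 0, 0)).
    exact: (subspaceD sD Df Dg).
  by apply: affineP; rewrite /= ?addr0.
rewrite -[(_, _, _)]/(loop_vector m x); move: x; apply: root_space_ind.
- split=> [|c x y Dx Dy]; first by rewrite loop_vector0; exact: sD.1.
  by rewrite loop_vector_linear; apply: sD.2.
- move=> x /weight_space0E wx; apply: weight_vector_decomposable.
  exact: affine_weight_loop_vector wx.
- move=> a x _ wx; apply: weight_vector_decomposable.
  exact: affine_weight_loop_vector wx.
Qed.

(** A subspace stable under the Cartan subalgebra is the sum of its weight components, so three
    kinds of weight vectors suffice to test an inclusion. *)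
Lemma graded_sub (S S' : set affine) : is_subspace S ->
  (forall (h : affine_cartan H) u, S u -> S (lie (iota h) u)) -> is_subspace S' ->
  (forall h : affine_cartan H, S (iota h) -> S' (iota h)) ->
  (forall a r x, D a -> W a x -> x != 0 -> S (loop_vector r x) -> S' (loop_vector r x)) ->
  (forall r x, r != 0 -> x \in H -> x != 0 -> S (loop_vector r x) -> S' (loop_vector r x)) ->
  S `<=` S'.
Proof.
move=> sS stS sS' S0 Sre Sim u Su.
have [s [w [us ww uE]]] := affine_decomposable u.
rewrite uE in Su; have Sw := component_mem affine_dual_sep sS stS us ww Su.
rewrite uE big_seq; apply: subspace_sum => // l ls.
have Swl := Sw _ ls; have wwl : AW l (w l) := ww l.
have [l0|l0] := eqVneq l 0.
  move: wwl; rewrite {1}l0 => /affine_weight0[h hE]; rewrite hE.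
  by apply: S0; rewrite -hE.
have [->|u0] := eqVneq (w l) 0; first exact: subspace0.
have [a [r [x [lE wE wx x0]]]] := affine_weight_nz wwl l0 u0.
rewrite wE in Swl *; have [a0|a0] := eqVneq a 0; last exact/Sre/Swl/x0/wx/nonzero_root/x0.
apply: Sim => //; last by apply/weight_space0E; rewrite -a0.
apply: contra_neq l0 => r0; rewrite lE a0 r0; apply/lfunP => h.
by rewrite affine_rootE mul0r addr0 !lfunE.
Qed.

(** * Coroots and reflections of real roots *)

Lemma affine_root_nz a r : a != 0 -> affine_root a r != 0.
Proof.
move=> /dual_nz[h ah]; apply: contra_neq ah => ar0.
by have := affine_rootE a r (h, 0, 0); rewrite ar0 lfunE /= mulr0 addr0.
Qed.

(** The coroot is [h] plus [r (kappa e f)] times c, and every [affine_root] vanishes on c.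
    Uniqueness holds because root spaces are lines and the value 2 fixes the scalar. *)
Lemma affine_coroot a r e f h : sl2_triple a e f h ->
  (coroot iota (affine_root a r)).1.1 = h /\ (coroot iota (affine_root a r)).2 = 0.
Proof.
move=> sl2; have a0 := sl2_triple_root_nz sl2; have [we wf ef ah] := sl2.
have e0 : e != 0.
  apply: contra_eq_neq ah => e0; move: ef; rewrite e0 lie0l => /esym hz.
  by rewrite -[h]vsvalK hz !linear0 eq_sym pnatr_eq0.
have f0 : f != 0.
  apply: contra_eq_neq ah => f0; move: ef; rewrite f0 lie0r => /esym hz.
  by rewrite -[h]vsvalK hz !linear0 eq_sym pnatr_eq0.
have Da : D a by exact: nonzero_root e0.
have : is_coroot iota (affine_root a r) (coroot iota (affine_root a r)).
  apply: (xgetPex 0); exists (h, r%:~R * kappa e f, 0); split.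
    by rewrite affine_rootE /= mulr0 addr0.
  exists (loop_vector r e), (loop_vector (- r) f); split.
  - exact: affine_weight_loop_vector.
  - by rewrite affine_rootN; exact: affine_weight_loop_vector.
  - by rewrite lie_loop_vector subrr eqxx ef.
move: (coroot _ _) => g [ag [x [y [wx wy gE]]]].
have [x0 xE wx0] := affine_weight_rootE (affine_root_nz r a0) wx.
rewrite affine_rootN in wy.
have [y0 yE wy0] : exists2 y0, y = loop_vector (- r) y0 & W (- a) y0.
  by apply: affine_weight_rootE wy; apply: affine_root_nz; rewrite oppr_eq0.
rewrite xE yE lie_loop_vector in gE.
have g2 : g.2 = 0 by exact: (congr1 (fun u : affine => u.2) gE).
split=> //; have g11 : vsval g.1.1 = lie x0 y0.
  have /loopP/(_ 0) := congr1 (fun u : affine => u.1.1) gE.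
  by rewrite /= subrr.
have [c xc] := root_space_line Da we e0 wx0.
have [c' yc] := root_space_line (root_opp Da) wf f0 wy0.
have gh : g.1.1 = (c * c') *: h.
  by apply: val_inj; rewrite /= [LHS]g11 xc yc lieZl lieZr scalerA ef.
rewrite affine_rootE g2 mulr0 addr0 gh linearZ /= ah in ag.
have cc : c * c' = 1.
  apply: (@mulIf _ (2%:R : F)); first by rewrite pnatr_eq0.
  by rewrite mul1r.
by rewrite gh cc scale1r.
Qed.

Lemma affine_reflectionE a b r s e f h (m : int) : sl2_triple a e f h ->
  (b h : F) = m%:~R ->
  affine_reflection kappa (affine_root a r) (affine_root b s) =
  affine_root (b - m%:~R *: a) (s - m * r).
Proof.
move=> sl2 bm; have [h1 h2] := affine_coroot r sl2.
rewrite /affine_reflection /root_reflection affine_rootE h1 h2 mulr0 addr0 bm.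
by rewrite affine_rootMz affine_rootN affine_rootD.
Qed.

(* The properties of a real closed subroot system that do not involve coroots;
   unlike real closed subroot systems, such a set may be empty. *)
Definition symmetric_closed (Psi : set adual) : Prop :=
  [/\ Psi `<=` real_roots H,
      forall a r, Psi (affine_root a r) -> Psi (affine_root (- a) (- r)),
      forall a b r s, Psi (affine_root a r) -> Psi (affine_root b s) -> D (a + b) ->
        Psi (affine_root (a + b) (r + s)) &
      forall a r s, Psi (affine_root a r) -> Psi (affine_root a s) ->
        Psi (affine_root a (2%:R * r - s))].

Lemma symmetric_closed_root Psi a r :
  symmetric_closed Psi -> Psi (affine_root a r) -> D a.
Proof. by case=> sub _ _ _ /sub/real_roots_affine. Qed.

(** Reflecting a root in itself gives its opposite. Reflecting [a + s delta] in [a + r delta] gives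
    [- a + (s - 2r) delta], whose opposite is the last condition. *)
Lemma real_closed_symmetric Psi :
  real_closed_subroot_system kappa Psi -> symmetric_closed Psi.
Proof.
move=> [_ sub refl add].
have DP a r : Psi (affine_root a r) -> D a by move=> /sub/real_roots_affine.
have refl_a a r s : Psi (affine_root a r) -> Psi (affine_root a s) ->
    Psi (affine_root (- a) (s - 2%:R * r)).
  move=> Par Pas; have Da := DP _ _ Par; have [e we e0] := root_vector Da.
  have [f [h sl2]] := sl2_triple_exists Da we e0; have [_ _ _ ah] := sl2.
  have := refl _ _ Par Pas; rewrite (affine_reflectionE _ _ (m := 2%:R) sl2) //.
  by congr (Psi (affine_root _ _)); rewrite scaler_nat mulr2n opprD addNKr.
have neg a r : Psi (affine_root a r) -> Psi (affine_root (- a) (- r)).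
  by move=> Par; have := refl_a _ _ _ Par Par; congr (Psi (affine_root _ _)); ring.
split=> // [a b r s Par Pbs Dab|a r s Par Pas].
  by rewrite -affine_rootD; apply: add => //; rewrite affine_rootD; exact/real_roots_affine.
by have := neg _ _ (refl_a _ _ _ Par Pas); rewrite opprK; congr (Psi (affine_root _ _)); ring.
Qed.

Lemma symmetric_closed0 : symmetric_closed set0.
Proof. by split. Qed.

(** A translation that takes one point of the fibre over [a] to another preserves the whole fibre,
    by [reflection_closed_shift]. *)
Lemma symmetric_closed_shift Psi a r t s : symmetric_closed Psi ->
  Psi (affine_root a r) -> Psi (affine_root a (r + t)) -> Psi (affine_root a s) ->
  Psi (affine_root a (s + t)).
Proof.
case=> _ _ _ PR.
exact: (@reflection_closed_shift [set s | Psi (affine_root a s)] (PR a)).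
Qed.

(** * The regular subalgebra of a closed set of real roots *)

(* Besides root vectors with weight in Psi, the condition on x (x) t^r admits
   the x in H for which ad (x (x) t^r) maps the real root spaces of Psi to one
   another. *)
Definition compatible (Psi : set adual) (r : int) (x : L) : Prop :=
  (exists2 a, Psi (affine_root a r) & W a x) \/
  (x \in H /\ forall a s, Psi (affine_root a s) -> (a (vsproj H x) : F) != 0 ->
    Psi (affine_root a (s + r))).

Definition regular_generators (Psi : set adual) : set affine :=
  [set u | (exists h : affine_cartan H, u = iota h) \/
     exists r x, u = loop_vector r x /\ compatible Psi r x].

Definition regular_of (Psi : set adual) : set affine :=
  lspan (regular_generators Psi).

Lemma regular_of_subspace Psi : is_subspace (regular_of Psi).
Proof. exact: lspan_subspace. Qed.

Lemma regular_of0 Psi : regular_of Psi 0.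
Proof. exact: (regular_of_subspace Psi).1. Qed.

Lemma regular_of_cartan Psi (h : affine_cartan H) : regular_of Psi (iota h).
Proof. by apply: lspan_gen; left; exists h. Qed.

Lemma regular_of_loop Psi r x : compatible Psi r x -> regular_of Psi (loop_vector r x).
Proof. by move=> c; apply: lspan_gen; right; exists r, x. Qed.

Lemma regular_generators_weight (Psi : set adual) u :
  regular_generators Psi u -> exists l : adual, AW l u.
Proof.
move=> [[h ->]|[r [x [-> [[a _ wx]|[/weight_space0E wx _]]]]]].
- by exists 0; exact: affine_weight_cartan.
- by exists (affine_root a r); exact: affine_weight_loop_vector.
- by exists (affine_root 0 r); exact: affine_weight_loop_vector.
Qed.

(** The bracket is a multiple of the coroot [h]. If [c h != 0], then [c + a] or [c - a] is a root or
    0. When it is a root, adding the two given roots in turn returns to [c], translated by [r + s];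
    when it is 0, [symmetric_closed_shift] applies. *)
Lemma compatible_coroot Psi a b r s x y : symmetric_closed Psi -> a + b = 0 ->
  Psi (affine_root a r) -> Psi (affine_root b s) -> W a x -> W b y ->
  compatible Psi (r + s) (lie x y).
Proof.
move=> SC ab Par Pbs wx wy; right.
have bE : b = - a by apply/eqP; rewrite -addr_eq0 addrC ab.
have {ab} Da := symmetric_closed_root SC Par; have [_ PN PD _] := SC.
rewrite bE in Pbs wy.
have xyH := lie_opp_weight wx wy; split=> // c u Pcu.
have [->|x0] := eqVneq x 0; first by rewrite lie0l !linear0 eqxx.
have [f [h sl2]] := sl2_triple_exists Da wx x0; have [_ wf ef ah] := sl2.
have f0 : f != 0.
  apply: contra_eq_neq ah => f0; move: ef; rewrite f0 lie0r => /esym hz.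
  by rewrite -[h]vsvalK hz !linear0 eq_sym pnatr_eq0.
have [k yE] := root_space_line (root_opp Da) wf f0 wy.
rewrite yE lieZr ef linearZ /= vsvalK linearZ /= => ch.
have {}ch : (c h : F) != 0 by apply: contra_neq ch => ->; exact: mulr0.
have Dc := symmetric_closed_root SC Pcu; have [v wv v0] := root_vector Dc.
have [ev|fv] := sl2_moves sl2 wv v0 ch.
  have [ac|ac] := eqVneq (a + c) 0.
    have cE : c = - a by apply/eqP; rewrite -addr_eq0 addrC ac.
    rewrite cE in Pcu *; apply: (symmetric_closed_shift SC (PN _ _ Par)) => //.
    by rewrite addKr.
  have Dac : D (a + c) by apply: nonzero_root ev => //; exact: weight_space_lie.
  have E : - a + (a + c) = c by rewrite addKr.
  have := PD _ _ _ _ Pbs (PD _ _ _ _ Par Pcu Dac); rewrite E => /(_ Dc).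
  by congr (Psi (affine_root _ _)); ring.
have [ac|ac] := eqVneq (- a + c) 0.
  have cE : c = a by apply/eqP; rewrite -subr_eq0 addrC ac.
  rewrite cE in Pcu *; have := PN _ _ Pbs; rewrite opprK => Pas.
  by apply: (symmetric_closed_shift SC Pas) => //; rewrite addrCA addNr addr0.
have Dac : D (- a + c) by apply: nonzero_root fv => //; exact: weight_space_lie.
have E : a + (- a + c) = c by rewrite addNKr.
have := PD _ _ _ _ Par (PD _ _ _ _ Pbs Pcu Dac); rewrite E => /(_ Dc).
by congr (Psi (affine_root _ _)); ring.
Qed.

Lemma regular_of_loop_lie Psi r s x y : symmetric_closed Psi ->
  compatible Psi r x -> compatible Psi s y ->
  regular_of Psi (loop_vector (r + s) (lie x y)).
Proof.
move=> SC; have [_ PN PD _] := SC.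
have zero k z : z = 0 -> regular_of Psi (loop_vector k z).
  by move=> ->; rewrite loop_vector0; exact: regular_of0.
have rootH a k l z w : Psi (affine_root a k) -> W a z -> w \in H ->
    (forall a s, Psi (affine_root a s) -> (a (vsproj H w) : F) != 0 ->
      Psi (affine_root a (s + l))) ->
    regular_of Psi (loop_vector (k + l) (lie w z)).
  move=> Pak wz wH cw; have := wz (vsproj H w); rewrite vsprojK // => ->.
  have [->|aw] := eqVneq (a (vsproj H w) : F) 0.
    by apply: zero; rewrite scale0r.
  apply: regular_of_loop; left; exists a; first exact: cw.
  exact: weight_spaceZ.
move=> [[a Par wx]|[xH cx]] [[b Pbs wy]|[yH cy]].
- have [ab|ab] := eqVneq (a + b) 0.
    by apply: regular_of_loop; exact: (compatible_coroot SC ab Par Pbs).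
  have [xy|xy] := eqVneq (lie x y) 0; first exact: zero.
  have wxy := weight_space_lie wx wy.
  apply: regular_of_loop; left; exists (a + b) => //.
  by apply: PD => //; exact: nonzero_root xy.
- rewrite lieC -scaleN1r loop_vectorZ.
  by apply: subspaceZ (regular_of_subspace _) (rootH _ _ _ _ _ Par wx yH cy).
- by rewrite addrC; exact: rootH Pbs wy xH cx.
- by apply: zero; exact: cartan_lie0.
Qed.

Lemma regular_of_subalgebra Psi : symmetric_closed Psi ->
  regular_subalgebra iota (regular_of Psi).
Proof.
move=> SC; have sS := regular_of_subspace Psi.
have cartanl (h : affine_cartan H) u : regular_generators Psi u ->
    regular_of Psi (lie (iota h) u).
  move=> Gu; have [l wu] := regular_generators_weight Gu.
  by rewrite wu; exact: (subspaceZ _ sS (lspan_gen Gu)).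
have closed u v : regular_of Psi u -> regular_of Psi v -> regular_of Psi (lie u v).
  move=> Su Sv; move: u Su.
  suff : regular_of Psi `<=` [set u | regular_of Psi (lie u v)] by [].
  apply: lspan_min => [|u Gu].
    split=> [|c u w Su Sw]; first by rewrite /= lie0l; exact: regular_of0.
    by rewrite /= lieDl lieZl; exact: sS.2.
  move: v Sv; suff : regular_of Psi `<=` [set v | regular_of Psi (lie u v)] by [].
  apply: lspan_min => [|v Gv].
    split=> [|c w w' Su Sw]; first by rewrite /= lie0r; exact: regular_of0.
    by rewrite /= lieDr lieZr; exact: sS.2.
  rewrite /=; case: (Gu) => [[h ->]|[r [x [-> cx]]]]; first exact: cartanl.
  case: Gv => [[h ->]|[s [y [-> cy]]]].
    have Gx : regular_generators Psi (loop_vector r x) by right; exists r, x.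
    by rewrite (lieC (loop_vector r x)); exact: (subspaceN sS (cartanl _ _ Gx)).
  (* The cocycle contributes a multiple of c, which lies in the Cartan subalgebra. *)
  have -> : lie (loop_vector r x) (loop_vector s y) =
      loop_vector (r + s) (lie x y) +
      iota (0, if r + s == 0 then r%:~R * kappa x y else 0, 0).
    rewrite lie_loop_vector; apply: affineP; rewrite /= ?addr0 ?add0r //.
    by rewrite monomial0 addr0.
  apply: (subspaceD sS); last exact: regular_of_cartan.
  exact: regular_of_loop_lie.
split; first by split.
by move=> h u Su; apply: closed => //; exact: regular_of_cartan.
Qed.

(** Pair the coefficient of t^r with a dual vector of [x]. If the root were missing from [Psi], this
    functional would vanish on all generators, but it is 1 on the given vector. *)
Lemma regular_of_real Psi a r x : D a -> W a x -> x != 0 ->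
  regular_of Psi (loop_vector r x) -> Psi (affine_root a r).
Proof.
move=> Da wx x0 Sx; apply: contrapT => nP.
have [y wy xy] := form_dual_vector wx x0.
have : regular_of Psi `<=` [set u : affine | kappa (u.1.1 r) y = 0].
  apply: lspan_min => [|u].
    split=> [|c u v ur vr]; first exact: form0l.
    change (kappa (c *: u.1.1 r + v.1.1 r) y = 0).
    by rewrite formDl formZl ur vr mulr0 addr0.
  have kH z : z \in H -> kappa z y = 0.
    move=> /weight_space0E wz; apply: form_orthogonal wz wy _.
    by rewrite add0r oppr_eq0; exact: root_nz.
  move=> [[h ->]|[s [z [-> cz]]]] /=; case: eqP => [rs|_]; rewrite ?form0l //.
    by apply: kH; exact: subvsP.
  case: cz => [[b Pbs wz]|[zH _]]; last exact: kH.
  apply: form_orthogonal wz wy _; rewrite subr_eq0.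
  by apply: contra_not_neq nP => <-; rewrite rs.
move=> /(_ _ Sx) /=; rewrite eqxx xy => /eqP.
by rewrite oner_eq0.
Qed.

(** As for real roots, now pairing with [[e, f]], which on [H] is evaluation of [a]. The generators
    from the Cartan subalgebra have degree 0, so [r != 0] discards them. *)
Lemma regular_of_imaginary Psi r x : symmetric_closed Psi -> r != 0 -> x \in H ->
  regular_of Psi (loop_vector r x) ->
  forall a s, D a -> Psi (affine_root a s) -> (a (vsproj H x) : F) != 0 ->
    Psi (affine_root a (s + r)).
Proof.
move=> SC r0 xH Sx a s Da Pas ax; apply: contrapT => nP.
have [e we e0] := root_vector Da; have [f wf ef] := form_dual_vector we e0.
have w0 : W 0 (lie e f) by apply/weight_space0E; exact: lie_opp_weight we wf.
have kE z : z \in H -> kappa z (lie e f) = a (vsproj H z).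
  by move=> zH; rewrite form_sym -{1}(vsprojK zH) (form_lie_cartan _ we wf) ef mulr1.
have : regular_of Psi `<=` [set u : affine | kappa (u.1.1 r) (lie e f) = 0].
  apply: lspan_min => [|u].
    split=> [|c u v ur vr]; first exact: form0l.
    change (kappa (c *: u.1.1 r + v.1.1 r) (lie e f) = 0).
    by rewrite formDl formZl ur vr mulr0 addr0.
  move=> [[h ->]|[k [z [-> cz]]]] /=.
    by rewrite (negPf r0) form0l.
  case: eqP => [rk|_]; last exact: form0l.
  case: cz => [[b Pbk wz]|[zH cz]].
    apply: form_orthogonal wz w0 _; rewrite addr0.
    exact/root_nz/(symmetric_closed_root SC Pbk).
  rewrite kE //; apply/eqP/negPn/negP => az; apply: nP.
  by rewrite rk; exact: cz.
move=> /(_ _ Sx) /=; rewrite eqxx kE // => /eqP.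
by rewrite (negPf ax).
Qed.

(** * Real roots of symmetric regular subalgebras *)

Definition real_part (S : set affine) : set adual := roots_of iota S `&` real_roots H.

Lemma real_part_loop (S : set affine) a r x : D a -> W a x -> x != 0 ->
  S (loop_vector r x) -> real_part S (affine_root a r).
Proof.
move=> Da wx x0 Sx; split; last exact/real_roots_affine.
have ux := loop_vector_nz r x0; have wux := affine_weight_loop_vector r wx.
split; last by exists (loop_vector r x).
split; last by exists (loop_vector r x).
by apply: affine_root_nz; exact: root_nz.
Qed.

Lemma real_rootsP l : real_roots H l -> exists a r, D a /\ l = affine_root a r.
Proof. by []. Qed.

Lemma real_part_root (S : set affine) a r : is_subspace S ->
  real_part S (affine_root a r) ->
  D a /\ forall x, W a x -> S (loop_vector r x).
Proof.
move=> sS [[_ [u [wu Su u0]]] /real_roots_affine Da]; split=> // x wx.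
have [z uE wz] := affine_weight_rootE (affine_root_nz r (root_nz Da)) wu.
have z0 : z != 0 by apply: contra_neq u0 => z0; rewrite uE z0 loop_vector0.
have [c ->] := root_space_line Da wz z0 wx.
by rewrite loop_vectorZ; apply: (subspaceZ _ sS); rewrite -uE.
Qed.

Lemma real_partS (S S' : set affine) : S `<=` S' -> real_part S `<=` real_part S'.
Proof.
by move=> SS l [[Dl [u [wu Su u0]]] Rl]; split=> //; split=> //; exists u; split=> //; exact: SS.
Qed.

Lemma real_part_setT : real_part setT = real_roots H.
Proof.
apply/seteqP; split=> [l []//|l /real_rootsP[a [r [Da ->]]]].
have [x wx x0] := root_vector Da.
exact: real_part_loop Da wx x0 _.
Qed.

Lemma regular_of_real_part Psi : symmetric_closed Psi -> real_part (regular_of Psi) = Psi.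
Proof.
move=> SC; have [sub _ _ _] := SC; apply/seteqP; split=> l.
  move=> Rl; have [_ /real_rootsP[a [r [Da lE]]]] := Rl.
  have [x wx x0] := root_vector Da; move: Rl; rewrite lE.
  move=> /(real_part_root (regular_of_subspace Psi))[_ /(_ x wx)].
  exact: regular_of_real.
move=> Pl; have [a [r [Da lE]]] := real_rootsP (sub _ Pl); have [x wx x0] := root_vector Da.
rewrite lE in Pl *.
by apply: (real_part_loop Da wx x0); apply: regular_of_loop; left; exists a.
Qed.

Lemma regular_of_symmetric Psi : symmetric_closed Psi ->
  symmetric_regular_subalgebra iota (regular_of Psi).
Proof.
move=> SC; split; first exact: regular_of_subalgebra.
have [_ PN _ _] := SC.
suff opp l : roots_of iota (regular_of Psi) l -> roots_of iota (regular_of Psi) (- l).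
  apply/seteqP; split=> [l /opp Nl|_ [l /opp Nl <-]] //.
  by exists (- l); rewrite ?opprK.
move=> [[l0 _] [u [wu Su u0]]].
have [a [r [x [lE uE wx x0]]]] := affine_weight_nz wu l0 u0.
rewrite lE affine_rootN; rewrite uE in Su; rewrite {}lE {wu} in l0.
have [a0|a0] := eqVneq a 0; last first.
  have Da : D a by exact: nonzero_root x0.
  have [y wy y0] := root_vector (root_opp Da).
  have [] // := @real_part_loop (regular_of Psi) _ (- r) _ (root_opp Da) wy y0.
  apply: regular_of_loop; left; exists (- a) => //.
  by apply: PN; apply: regular_of_real wx x0 Su.
rewrite {}a0 in l0 wx *; have xH : x \in H by exact/weight_space0E.
have r0 : r != 0.
  apply: contra_neq l0 => ->; apply/lfunP => h.
  by rewrite affine_rootE mul0r addr0 !lfunE.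
(* Translating the fibre over [b] by [- r] is opposite to translating the fibre over [- b] by
   [r]. *)
have Sy : regular_of Psi (loop_vector (- r) x).
  apply: regular_of_loop; right; split=> // b s Pbs bx.
  have Db := symmetric_closed_root SC Pbs.
  have bx' : ((- b) (vsproj H x) : F) != 0 by rewrite opp_lfunE oppr_eq0.
  have := regular_of_imaginary SC r0 xH Su (root_opp Db) (PN _ _ Pbs) bx'.
  by move/PN; rewrite opprK opprD opprK.
have nz : - affine_root 0 r != 0 by rewrite oppr_eq0.
have wy : AW (affine_root (- 0) (- r)) (loop_vector (- r) x).
  by apply: affine_weight_loop_vector; rewrite oppr0.
have y0 := loop_vector_nz (- r) x0.
rewrite affine_rootN in nz.
split; last by exists (loop_vector (- r) x).
by split=> //; exists (loop_vector (- r) x).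
Qed.

Lemma affine_weight_lie (l m : adual) (u v : affine) :
  AW l u -> AW m v -> AW (l + m) (lie u v).
Proof.
move=> wu wv h; rewrite lie_derivation wu wv lieZl lieZr -scalerDl.
by rewrite add_lfunE.
Qed.

(** Only the loop coordinate is tracked, since iterated brackets may acquire a central term. *)
Lemma iter_loop_vector r s x y k (u := iter k (lie (loop_vector r x)) (loop_vector s y)) :
  u.1.1 = monomial (s + k%:Z * r) (iter k (lie x) y).
Proof.
rewrite /u {u}; elim: k => [|k IH]; first by rewrite /= mul0r addr0.
rewrite iterS; set w := iter k _ _ in IH *.
have w2 : w.2 = 0 by rewrite /w; case: (k).
change (loop_br (monomial r x) w.1.1 + 0 *: loop_deg w.1.1 -
  (w.2 : F) *: loop_deg (monomial r x) = monomial (s + k.+1%:Z * r) (iter k.+1 (lie x) y)).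
rewrite w2 !scale0r addr0 subr0 IH loop_br_monomial; congr (monomial _ _).
by rewrite intS; ring.
Qed.

Lemma real_part_iter (S : set affine) a b r s x y k : is_lie_subalgebra S ->
  S (loop_vector r x) -> S (loop_vector s y) -> W a x -> W b y ->
  iter k (lie x) y != 0 -> D (b + a *+ k) ->
  real_part S (affine_root (b + a *+ k) (s + k%:Z * r)).
Proof.
move=> [sS clS] Sx Sy wx wy it0 Dba.
pose u := iter k (lie (loop_vector r x)) (loop_vector s y).
have Su : S u by rewrite /u; elim: (k) => [//|n IH]; exact: clS.
have wu : AW (affine_root (b + a *+ k) (s + k%:Z * r)) u.
  rewrite /u; elim: (k) => [|n IH].
    by rewrite mul0r !addr0; exact: affine_weight_loop_vector.
  have := affine_weight_lie (affine_weight_loop_vector r wx) IH.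
  rewrite affine_rootD; congr (AW (affine_root _ _) _); first by rewrite mulrS addrCA.
  by rewrite intS; ring.
have u0 : u != 0.
  apply: contra_neq it0 => u0; have := iter_loop_vector r s x y k.
  by rewrite -/u u0 => /esym/monomial_eq0.
split; last exact/real_roots_affine.
split; last by exists u.
split; last by exists u.
exact/affine_root_nz/root_nz.
Qed.

Lemma real_part_opp (S : set affine) a r : symmetric_regular_subalgebra iota S ->
  real_part S (affine_root a r) -> real_part S (affine_root (- a) (- r)).
Proof.
move=> [_ symS] [Ra /real_roots_affine Da]; split; last exact/real_roots_affine/root_opp.
move: Ra; rewrite {1}symS => -[l Rl lE].
by rewrite -affine_rootN -lE opprK.
Qed.

(** A reflection is carried out inside [S] by iterating the bracket with [e] or [f] as in
    [sl2_string], where [f] is available by symmetry. Sums come from [lie_root_vectors_nz]. *)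
Lemma real_part_real_closed (S : set affine) : symmetric_regular_subalgebra iota S ->
  real_part S !=set0 -> real_closed_subroot_system kappa (real_part S).
Proof.
move=> symS S0; have [[[sS clS] stS] _] := symS; split=> //.
- by move=> l [].
- move=> l l' Ra Rb; have [_ /real_rootsP[a [r [Da aE]]]] := Ra.
  have [_ /real_rootsP[b [s [Db bE]]]] := Rb; move: Ra Rb; rewrite aE bE => Ra Rb.
  have [e we e0] := root_vector Da; have [f [h sl2]] := sl2_triple_exists Da we e0.
  have [_ wf _ _] := sl2; have [v wv v0] := root_vector Db.
  have [m bm Dm] := sl2_reflection sl2 Db.
  have [_ Sv] := real_part_root sS Rb; have {}Sv := Sv _ wv.
  rewrite (affine_reflectionE _ _ sl2 bm).
  have [m' [bm' fv ev]] := sl2_string sl2 Db wv v0.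
  have mm : m' = m by apply/eqP; rewrite -(eqr_int F) -bm' bm.
  rewrite {m' bm'}mm in fv ev; have [m0|m0] := leP 0 m.
    have [_ Sf] := real_part_root sS (real_part_opp symS Ra); have {}Sf := Sf _ wf.
    have E : b + (- a) *+ `|m|%N = b - m%:~R *: a.
      by rewrite mulNrn -scaler_nat pmulrn gez0_abs.
    rewrite -E in Dm *; have := real_part_iter (conj sS clS) Sf Sv wf wv (fv m0) Dm.
    by congr (real_part S (affine_root _ _)); rewrite gez0_abs // mulrN.
  have [_ Se] := real_part_root sS Ra; have {}Se := Se _ we.
  have E : b + a *+ `|m|%N = b - m%:~R *: a.
    by rewrite -scaler_nat pmulrn ltz0_abs // intrN scaleNr.
  rewrite -E in Dm *; have := real_part_iter (conj sS clS) Se Sv we wv (ev (ltW m0)) Dm.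
  by congr (real_part S (affine_root _ _)); rewrite ltz0_abs // mulNr.
- move=> l l' Ra Rb; have [_ /real_rootsP[a [r [Da aE]]]] := Ra.
  have [_ /real_rootsP[b [s [Db bE]]]] := Rb.
  move: Ra Rb; rewrite aE bE affine_rootD => Ra Rb /real_roots_affine Dab.
  have [x wx x0] := root_vector Da; have [y wy y0] := root_vector Db.
  have [_ Sx] := real_part_root sS Ra; have [_ Sy] := real_part_root sS Rb.
  have := @real_part_iter S a b r s x y 1 (conj sS clS) (Sx _ wx) (Sy _ wy) wx wy.
  rewrite mulr1n mul1r (addrC b) (addrC s); apply=> //.
  exact: (lie_root_vectors_nz Da Db Dab wx x0 wy y0).
Qed.

Lemma real_part_symmetric_closed (S : set affine) :
  symmetric_regular_subalgebra iota S -> symmetric_closed (real_part S).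
Proof.
move=> symS; have [S0|/set0P S0] := eqVneq (real_part S) set0.
  by rewrite S0; exact: symmetric_closed0.
exact/real_closed_symmetric/real_part_real_closed.
Qed.

(** Hence [regular_of] gives the largest subalgebra with its real part. If [x] in [H] has
    [a x != 0], bracketing with [x] in degree [r] carries the root space of [a + s delta] onto that
    of [a + (s + r) delta]. *)
Lemma sub_regular_of (S : set affine) : symmetric_regular_subalgebra iota S ->
  S `<=` regular_of (real_part S).
Proof.
move=> symS; have [[[sS clS] stS] _] := symS.
apply: graded_sub => //; first exact: regular_of_subspace.
- by move=> h _; exact: regular_of_cartan.
- move=> a r x Da wx x0 Sx; apply: regular_of_loop; left; exists a => //.
  exact: real_part_loop Da wx x0 Sx.
- move=> r x r0 xH x0 Sx; apply: regular_of_loop; right; split=> // a s Ras ax.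
  have [Da Sa] := real_part_root sS Ras; have [y wy y0] := root_vector Da.
  apply: (real_part_loop Da wy y0); have := clS _ _ Sx (Sa _ wy).
  have xy : lie x y = (a (vsproj H x) : F) *: y by rewrite -wy vsprojK.
  rewrite lie_loop_vector (addrC r) xy.
  have -> : kappa x y = 0.
    have /weight_space0E wx := xH; apply: form_orthogonal wx wy _.
    by rewrite add0r; exact: root_nz.
  rewrite mulr0 if_same -[(_, _, _)]/(loop_vector _ _) loop_vectorZ.
  exact: subspace_scale.
Qed.

Lemma affine_split_center (u : affine) : u.2 = 0 ->
  u = (u.1.1, 0, 0) + (u.1.2 : F) *: ((0, 1, 0) : affine).
Proof.
move=> u0; apply: affineP => /=; rewrite ?scaler0 ?addr0 ?add0r //.
by rewrite -[_ *: _]/(_ * _) mulr1.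
Qed.

Lemma loop_part_add (f g : loop L) :
  (f + g, 0, 0) = ((f, 0, 0) : affine) + (g, 0, 0).
Proof. by apply: affineP; rewrite /= ?addr0. Qed.

(** The [x] lying in [S] in every degree form an ideal containing the root vectors, hence all of
    [L]. A dual pair in degrees 1 and -1 then produces c. *)
Lemma real_part_full (S : set affine) : regular_subalgebra iota S ->
  real_part S = real_roots H -> [set u : affine | u.2 = 0] `<=` S.
Proof.
move=> [[sS clS] stS] full.
have Sroot a r x : D a -> W a x -> S (loop_vector r x).
  move=> Da wx; have : real_part S (affine_root a r) by rewrite full; exact/real_roots_affine.
  by move=> /(real_part_root sS)[_]; exact.
have Sall x n : S (loop_vector n x).
  suff : forall x, [set x | forall n, S (loop_vector n x)] x by apply.
  apply: simple_ideal.
  - split=> [k|c y z Sy Sz k]; first by rewrite loop_vector0; exact: sS.1.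
    by rewrite loop_vector_linear; apply: sS.2; [exact: Sy | exact: Sz].
  - move=> y z Sz; move: y.
    apply: (root_space_ind (S := [set y | forall n, S (loop_vector n (lie y z))])).
    + split=> [k|c y y' Sy Sy' k]; first by rewrite lie0l loop_vector0; exact: sS.1.
      by rewrite lieDl lieZl loop_vector_linear; apply: sS.2; [exact: Sy | exact: Sy'].
    + move=> y yH k.
      have := stS (vsproj H y, 0, 0) _ (Sz k).
      have -> : iota (vsproj H y, 0, 0) = loop_vector 0 y.
        by apply: affineP => //=; rewrite vsprojK.
      by rewrite lie_loop_vector add0r mul0r if_same.
    + move=> a y Da wy k; have := clS _ _ (Sroot _ 0 _ Da wy) (Sz k).
      by rewrite lie_loop_vector add0r mul0r if_same.
  - have [a Da] := root_exists; have [y wy y0] := root_vector Da.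
    by exists y => // k; exact: Sroot wy.
have Sc : S (0, 1, 0).
  have [a Da] := root_exists; have [x wx x0] := root_vector Da.
  have [y wy xy] := form_dual_vector wx x0.
  have := subspaceB sS (clS _ _ (Sall x 1) (Sall y (-1))) (Sall (lie x y) 0).
  rewrite lie_loop_vector subrr eqxx xy mulr1.
  by congr S; apply: affineP; rewrite /= ?subrr ?subr0.
move=> u /= u0; rewrite (affine_split_center u0).
apply: (subspaceD sS); last exact: (subspaceZ _ sS).
elim/loop_ind: u.1.1 => [|f g Sf Sg|n x]; first exact: sS.1.
  by rewrite loop_part_add; exact: (subspaceD sS Sf Sg).
exact: Sall.
Qed.

(** * Maximality *)

Lemma derived_subspace : is_subspace (derived_algebra L).
Proof. exact: lspan_subspace. Qed.

Lemma simple_perfect x : derived_algebra L x.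
Proof.
move: x; apply: simple_ideal; first exact: derived_subspace.
  by move=> x y _; apply: lspan_gen; exists x, y.
have [[x [y xy]] _] := simpleL.
by exists (lie x y) => //; apply: lspan_gen; exists x, y.
Qed.

Lemma derived_affine : derived_algebra affine = [set u : affine | u.2 = 0].
Proof.
have sD : is_subspace (derived_algebra affine) by exact: lspan_subspace.
apply/seteqP; split.
  apply: lspan_min => [|_ [x [y ->]]//].
  by split=> [//|c u v /= u0 v0]; rewrite u0 v0 scaler0 addr0.
have Dn n x : derived_algebra affine (loop_vector n x).
  move: x (simple_perfect x).
  suff : derived_algebra L `<=` [set x | derived_algebra affine (loop_vector n x)] by [].
  apply: lspan_min => [|_ [x [y ->]]].
    split=> [|c y z Dy Dz] /=; first by rewrite loop_vector0; exact: sD.1.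
    by rewrite loop_vector_linear; exact: sD.2.
  apply: lspan_gen; exists (loop_vector 0 x), (loop_vector n y).
  by rewrite lie_loop_vector add0r mul0r if_same.
have Dc : derived_algebra affine (0, 1, 0).
  have [a Da] := root_exists; have [x wx x0] := root_vector Da.
  have [y wy xy] := form_dual_vector wx x0.
  have D1 : derived_algebra affine (lie (loop_vector 1 x) (loop_vector (-1) y)).
    by apply: lspan_gen; exists (loop_vector 1 x), (loop_vector (-1) y).
  have := subspaceB sD D1 (Dn 0 (lie x y)).
  rewrite lie_loop_vector subrr eqxx xy mulr1.
  by congr (derived_algebra affine); apply: affineP; rewrite /= ?subrr ?subr0.
move=> u /= u0; rewrite (affine_split_center u0).
apply: (subspaceD sD); last exact: (subspaceZ _ sD).
elim/loop_ind: u.1.1 => [|f g Df Dg|n x]; first exact: sD.1.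
  by rewrite loop_part_add; exact: (subspaceD sD Df Dg).
exact: Dn.
Qed.

Lemma regular_of_proper Psi : symmetric_closed Psi -> Psi <> real_roots H ->
  regular_of Psi <> setT.
Proof.
by move=> SC nfull E; apply: nfull; rewrite -(regular_of_real_part SC) E real_part_setT.
Qed.

Lemma codim1_eq_setT (S : set affine) u : is_subspace S ->
  [set u : affine | u.2 = 0] `<=` S -> S u -> u.2 != 0 -> S = setT.
Proof.
move=> sS KS Su u0; apply/seteqP; split=> // v _.
rewrite -[v](addrNK (((v.2 : F) / (u.2 : F)) *: u)); apply: (subspaceD sS).
  apply: KS; change ((v.2 : F) - (v.2 : F) / (u.2 : F) * (u.2 : F) = 0).
  by rewrite divfK // subrr.
exact: (subspaceZ _ sS).
Qed.

Lemma regular_of_maximal Psi : maximal_real_closed_subroot_system kappa Psi ->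
  maximal_symmetric_regular_subalgebra iota (regular_of Psi) /\
  regular_of Psi <> derived_algebra affine.
Proof.
move=> [RC nfull maxP]; have SC := real_closed_symmetric RC.
split; last first.
  rewrite derived_affine => E; have := @regular_of_cartan Psi (0, 0, 1).
  by rewrite E /= => /eqP; rewrite oner_eq0.
split; [exact: regular_of_symmetric | exact: regular_of_proper |].
move=> S' symS' nT sub.
have PR : Psi `<=` real_part S'.
  by rewrite -{1}(regular_of_real_part SC); exact: real_partS.
have RC' : real_closed_subroot_system kappa (real_part S').
  by apply: real_part_real_closed => //; have [[l Pl] _ _ _] := RC; exists l; exact: PR.
have nfull' : real_part S' <> real_roots H.
  (* A full real part puts the derived algebra inside [S'], which also contains d. *)
  move=> full; apply: nT; have [[[sS' _] _] _] := symS'.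
  apply: (@codim1_eq_setT _ (iota (0, 0, 1))) => //; last by rewrite /= oner_eq0.
    by apply: real_part_full full; case: symS'.
  by apply: sub; exact: regular_of_cartan.
apply/seteqP; split=> //; have := sub_regular_of symS'.
by rewrite (maxP _ RC' nfull' PR).
Qed.

(** * Gradients and their full preimages *)

Definition gradient (Psi : set adual) : set dual :=
  [set a | exists r, Psi (affine_root a r)].

Definition lift (G : set dual) : set adual :=
  [set l | exists a r, G a /\ l = affine_root a r].

Lemma liftE G a r : lift G (affine_root a r) <-> G a.
Proof.
split=> [[b [s [Gb /affine_root_inj[-> _]]]]//|Ga].
by exists a, r.
Qed.

Lemma lift_symmetric_closed G : G `<=` D -> (forall a, G a -> G (- a)) ->
  (forall a b, G a -> G b -> D (a + b) -> G (a + b)) -> symmetric_closed (lift G).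
Proof.
move=> GD GN GA; split.
- by move=> _ [a [r [Ga ->]]]; exact/real_roots_affine/GD.
- by move=> a r /liftE Ga; exact/liftE/GN.
- by move=> a b r s /liftE Ga /liftE Gb Dab; exact/liftE/GA.
- by move=> a r s /liftE Ga _; exact/liftE.
Qed.

Lemma gradient_lift Psi : symmetric_closed Psi -> symmetric_closed (lift (gradient Psi)).
Proof.
move=> SC; have [_ PN PD _] := SC; apply: lift_symmetric_closed.
- by move=> a [r Par]; exact: symmetric_closed_root Par.
- by move=> a [r Par]; exists (- r); exact: PN.
- by move=> a b [r Par] [s Pbs] Dab; exists (r + s); exact: PD.
Qed.

Lemma lift_full G : lift G = real_roots H -> D `<=` G.
Proof. by move=> E a Da; apply/(liftE _ a 0); rewrite E; exact/real_roots_affine. Qed.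

Lemma regular_ofS Psi Psi' : Psi `<=` Psi' ->
  (forall r x, x \in H -> compatible Psi r x -> compatible Psi' r x) ->
  regular_of Psi `<=` regular_of Psi'.
Proof.
move=> PP cP; apply: lspan_min; first exact: regular_of_subspace.
move=> _ [[h ->]|[r [x [-> cx]]]]; first exact: regular_of_cartan.
apply: regular_of_loop; case: (cx) => [[a Par wx]|[xH _]]; last exact: cP.
by left; exists a => //; exact: PP.
Qed.

Lemma regular_of_lift Psi G : symmetric_closed Psi -> gradient Psi `<=` G ->
  regular_of Psi `<=` regular_of (lift G).
Proof.
move=> SC gG; have [sub _ _ _] := SC; apply: regular_ofS => [l Pl|r x xH _].
  have [a [r [Da lE]]] := real_rootsP (sub _ Pl); rewrite lE in Pl *.
  by apply/liftE/gG; exists r.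
by right; split=> // a s /liftE Ga _; exact/liftE.
Qed.

(** The derived algebra is a hyperplane, so a full real part would leave only it and the whole
    algebra. Otherwise [S] sits in the proper subalgebra [regular_of (real_part S)]. *)
Lemma maximal_eq_regular_of (S : set affine) :
  maximal_symmetric_regular_subalgebra iota S -> S <> derived_algebra affine ->
  real_part S <> real_roots H /\ S = regular_of (real_part S).
Proof.
move=> [symS nT maxS] nder.
have nfull : real_part S <> real_roots H.
  move=> full; apply: nder; rewrite derived_affine.
  have [regS _] := symS; have [[sS _] _] := regS.
  have KS := real_part_full regS full.
  apply/seteqP; split=> // u Su; apply/eqP/negPn/negP => u0.
  by apply: nT; exact: (codim1_eq_setT sS KS Su u0).
split=> //; apply/esym/maxS.
- exact/regular_of_symmetric/real_part_symmetric_closed.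
- exact: regular_of_proper (real_part_symmetric_closed symS) nfull.
- exact: sub_regular_of.
Qed.

(* Over a full gradient, the set of translations preserving each fibre is the
   same for all roots, by irreducibility; hence enlarging Psi can only enlarge
   the imaginary part of regular_of Psi. *)
Lemma regular_of_full_gradient Psi Psi' : symmetric_closed Psi -> symmetric_closed Psi' ->
  Psi `<=` Psi' -> D `<=` gradient Psi -> regular_of Psi `<=` regular_of Psi'.
Proof.
move=> SC SC' PP full; have [_ PN PD _] := SC'; apply: regular_ofS => // r x xH cx.
have [x0|x0] := pselect (forall a, D a -> (a (vsproj H x) : F) = 0).
  right; split=> // a s Pas.
  by rewrite x0 ?eqxx //; exact: symmetric_closed_root Pas.
have [a0 Da0 a0x] : exists2 a, D a & (a (vsproj H x) : F) != 0.
  apply: contrapT => nx; apply: x0 => a Da; apply/eqP/negPn/negP => ax.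
  by apply: nx; exists a.
have {}cx b s : Psi (affine_root b s) -> (b (vsproj H x) : F) != 0 ->
    Psi (affine_root b (s + r)).
  (* In the root vector alternative the nonzero [x] would have weight 0 as well as weight [b']. *)
  case: cx => [[b' Pb'r wx]|[_ cx]]; last exact: cx.
  move/weight_space0E: xH => w0x.
  have x1 : x != 0 by apply: contra_neq a0x => ->; rewrite !linear0.
  have /eqP := root_nz (symmetric_closed_root SC Pb'r); case; apply/lfunP => h.
  have := wx h; rewrite (w0x h) !lfunE /= scale0r => /esym/eqP.
  by rewrite scaler_eq0 (negPf x1) orbF => /eqP.
pose T := [set a | D a /\ forall s, Psi' (affine_root a s) ->
  Psi' (affine_root a (s + r)) /\ Psi' (affine_root a (s - r))].
have DT : D `<=` T.
  apply: roots_irreducible.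
  - by move=> a [].
  - exists a0; split=> // s Pa0s; have [s0 Pa0s0] := full _ Da0.
    have P1 := PP _ Pa0s0; have P2 := PP _ (cx _ _ Pa0s0 a0x).
    split; first exact: (symmetric_closed_shift SC' P1 P2 Pa0s).
    by apply: (symmetric_closed_shift SC' P2 _ Pa0s); rewrite addrK.
  - move=> a [Da Ta]; split; first exact: root_opp.
    move=> s /PN; rewrite opprK => /Ta[/PN P1 /PN P2].
    by split; [move: P2 | move: P1]; congr (Psi' (affine_root _ _)); ring.
  - move=> a b [Da Ta] Db Dab; split=> // u Pu.
    (* Subtracting and adding back this root carries invariance from the fibre over [a] to that over
       [a + b]. *)
    have [v /PP Pbv] := full _ Db.
    have E : a + b + - b = a by rewrite addrK.
    have := PD _ _ _ _ Pu (PN _ _ Pbv); rewrite E => /(_ Da)/Ta[P1 P2].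
    have Q1 := PD _ _ _ _ P1 Pbv Dab; have Q2 := PD _ _ _ _ P2 Pbv Dab.
    by split; [move: Q1 | move: Q2]; congr (Psi' (affine_root _ _)); ring.
right; split=> // b s Pbs _.
by have [_ /(_ s Pbs)[]] := DT b (symmetric_closed_root SC' Pbs).
Qed.

(** Adding a point of the nonempty fibre over [c] makes a full fibre over [b] into one over [b + c],
    so [roots_irreducible] spreads fullness to all roots. *)
Lemma full_fibre (Psi : set adual) a : symmetric_closed Psi -> D `<=` gradient Psi ->
  (forall r, Psi (affine_root a r)) -> Psi = real_roots H.
Proof.
move=> SC full Pa; have [sub PN PD _] := SC.
pose T := [set b | forall r, Psi (affine_root b r)].
have DT : D `<=` T.
  apply: roots_irreducible.
  - by move=> b Tb; exact: (symmetric_closed_root SC (Tb 0)).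
  - by exists a.
  - by move=> b Tb r; rewrite -[r]opprK; exact: PN.
  - move=> b c Tb Dc Dbc r; have [s Pcs] := full _ Dc.
    by have := PD _ _ _ _ (Tb (r - s)) Pcs Dbc; rewrite subrK.
apply/seteqP; split=> // l /real_rootsP[b [r [Db ->]]].
exact: DT.
Qed.

Lemma maximal_real_part (S : set affine) :
  maximal_symmetric_regular_subalgebra iota S -> S <> derived_algebra affine ->
  real_part S !=set0 -> maximal_real_closed_subroot_system kappa (real_part S).
Proof.
move=> maxS nder ne; have [nfull SE] := maximal_eq_regular_of maxS nder.
have [symS nT maxS'] := maxS; have SC := real_part_symmetric_closed symS.
split=> //; first exact: real_part_real_closed.
set Psi := real_part S in ne nfull SE SC *.
(* The maximality of [S], transferred to systems of real roots. *)
have bigger Phi : symmetric_closed Phi -> Phi <> real_roots H ->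
    regular_of Psi `<=` regular_of Phi -> Psi = Phi.
  move=> SCF nF sub; rewrite -(regular_of_real_part SCF) -(regular_of_real_part SC).
  congr real_part; apply/esym; rewrite -SE in sub *; apply: maxS' => //.
    exact: regular_of_symmetric.
  exact: regular_of_proper.
move=> Psi' /real_closed_symmetric SC' nfull' PP; have [sub' _ _ _] := SC'.
have gg : gradient Psi `<=` gradient Psi' by move=> a [r Par]; exists r; exact: PP.
have sublift (G : set dual) l : Psi' l -> gradient Psi' `<=` G -> lift G l.
  move=> Pl gG; have [a [r [Da lE]]] := real_rootsP (sub' _ Pl); rewrite lE in Pl *.
  by apply/liftE/gG; exists r.
(* If the gradient of [Psi'] is not full, its preimage is proper and contains [Psi'], and by
   [bigger] it equals [Psi]. *)
have [full'|nf'] := pselect (D `<=` gradient Psi'); last first.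
  apply/seteqP; split=> // l /sublift /(_ (@subset_refl _ _)).
  rewrite -(bigger (lift (gradient Psi'))) //; first exact: gradient_lift.
    by move/lift_full.
  exact: regular_of_lift.
have [full|nf] := pselect (D `<=` gradient Psi).
  by apply/esym/bigger => //; exact: regular_of_full_gradient.
have PE : Psi = lift (gradient Psi).
  apply: bigger; first exact: gradient_lift.
    by move/lift_full.
  exact: regular_of_lift.
case: ne => l Pl; have [sub _ _ _] := SC.
have [a [r [Da lE]]] := real_rootsP (sub _ Pl).
(* As [Psi] is a full preimage, [Psi'] contains the entire fibre over [a], and its gradient is
   full. *)
case: nfull'; apply: (full_fibre SC' full' (a := a)) => s.
by apply: PP; rewrite PE; apply/liftE; exists r; rewrite -lE.
Qed.

Lemma double_not_root a : D a -> ~ D (a + a).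
Proof.
move=> Da Daa; have [x wx x0] := root_vector Da.
by have := lie_root_vectors_nz Da Da Daa wx x0 wx x0; rewrite liexx eqxx.
Qed.

(** Without real roots [S] would be [regular_of set0], which is contained in the subalgebra of the
    preimage of [a] and [- a]. A third root makes the latter proper, and it has real roots. *)
Lemma maximal_real_part_nonempty (S : set affine) : (1 < \dim H)%N ->
  maximal_symmetric_regular_subalgebra iota S -> S <> derived_algebra affine ->
  real_part S !=set0.
Proof.
move=> rk maxS nder; apply/set0P/negP => /eqP ne.
have [_] := maximal_eq_regular_of maxS nder; rewrite ne => SE.
have [_ _ maxS'] := maxS.
have [a Da] := root_exists; have [b [Db ba bNa]] := third_root a rk.
pose G := [set c : dual | c = a \/ c = - a].
have SC : symmetric_closed (lift G).
  apply: lift_symmetric_closed.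
  - by move=> c [->|->] //; exact: root_opp.
  - by move=> c [->|->]; [right | left; rewrite opprK].
  - have D0 c : D c -> c <> 0 by move=> /root_nz/eqP.
    move=> c d [->|->] [->|->] Dcd.
    + by case: (double_not_root Da).
    + by case: (D0 _ Dcd); rewrite subrr.
    + by case: (D0 _ Dcd); rewrite addNr.
    + by case: (double_not_root (root_opp Da)).
have nlift : lift G <> real_roots H.
  by move=> /lift_full/(_ b Db)[/eqP|/eqP]; rewrite ?(negPf ba) ?(negPf bNa).
have E : regular_of (lift G) = S.
  apply: maxS'; [exact: regular_of_symmetric | exact: regular_of_proper |].
  rewrite SE; apply: regular_of_lift; first exact: symmetric_closed0.
  by move=> c [].
have : lift G (affine_root a 0) by apply/liftE; left.
by rewrite -(regular_of_real_part SC) E ne.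
Qed.

(** * A maximal real closed subroot system for every prime *)

Definition multiples (p : nat) : set adual :=
  [set l | exists a s, D a /\ l = affine_root a (p%:Z * s)].

Lemma multiplesE p a r : multiples p (affine_root a r) <-> D a /\ (p%:Z %| r)%Z.
Proof.
split=> [[b [s [Db /affine_root_inj[-> ->]]]]|[Da /dvdzP[s rE]]].
  by split=> //; exact: dvdz_mulr.
by exists a, s; rewrite rE mulrC.
Qed.

Lemma multiples_real_closed p : real_closed_subroot_system kappa (multiples p).
Proof.
split.
- by have [a Da] := root_exists; exists (affine_root a 0); apply/multiplesE; rewrite dvdz0.
- by move=> _ [a [s [Da ->]]]; exact/real_roots_affine.
- move=> _ _ [a [r [Da ->]]] [b [s [Db ->]]]; have [e we e0] := root_vector Da.
  have [f [h sl2]] := sl2_triple_exists Da we e0.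
  have [m bm Dm] := sl2_reflection sl2 Db.
  rewrite (affine_reflectionE _ _ sl2 bm); apply/multiplesE; split=> //.
  by rewrite (mulrCA m) -mulrBr dvdz_mulr.
- move=> _ _ [a [r [Da ->]]] [b [s [Db ->]]]; rewrite affine_rootD.
  by move=> /real_roots_affine Dab; apply/multiplesE; rewrite -mulrDr dvdz_mulr.
Qed.

Lemma multiples_inj p q : multiples p = multiples q -> p = q.
Proof.
have [a Da] := root_exists.
have dvd m n : multiples m = multiples n -> (n %| m)%N.
  move=> E; have : multiples m (affine_root a m%:Z).
    by apply/multiplesE; split=> //; exact: dvdzz.
  by rewrite E => /multiplesE[_]; rewrite dvdzE.
by move=> E; apply/eqP; rewrite eqn_dvd !dvd.
Qed.

(** A larger system contains some [a + t delta] with [t] prime to [p]. Its fibre over [a] contains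
    0, hence is a group; it contains [p] and [t], so by Bezout it is full, and [full_fibre]
    concludes. *)
Lemma multiples_maximal p : prime p ->
  maximal_real_closed_subroot_system kappa (multiples p).
Proof.
move=> pp; split; first exact: multiples_real_closed.
  have [a Da] := root_exists => E.
  have /multiplesE[_] : multiples p (affine_root a 1) by rewrite E; exact/real_roots_affine.
  by rewrite dvdzE /= dvdn1 => /eqP p1; rewrite p1 in pp.
move=> Psi' /real_closed_symmetric SC nfull PP; have [sub PN PD PR] := SC.
apply/seteqP; split=> // l Pl; apply: contrapT => nl; apply: nfull.
have [a [t [Da lE]]] := real_rootsP (sub _ Pl); rewrite {}lE in Pl nl.
have Pp b k : D b -> Psi' (affine_root b (k * p%:Z)).
  by move=> Db; apply: PP; apply/multiplesE; rewrite dvdz_mull.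
have P0 : Psi' (affine_root a 0) by have := Pp a 0 Da; rewrite mul0r.
have P1 : Psi' (affine_root a p%:Z) by have := Pp a 1 Da; rewrite mul1r.
apply: (full_fibre SC (a := a)) => [b Db|r].
  by exists 0; have := Pp b 0 Db; rewrite mul0r.
have shift k s : Psi' (affine_root a k) -> Psi' (affine_root a s) ->
    Psi' (affine_root a (s + k)).
  move=> Pk Ps; apply: (symmetric_closed_shift SC P0) => //.
  by rewrite add0r.
have multiple k s : Psi' (affine_root a k) -> Psi' (affine_root a (s * k)).
  move=> Pk; have Nk : Psi' (affine_root a (- k)).
    by have := PR _ _ _ P0 Pk; rewrite mulr0 add0r.
  elim/int_ind: s => [|n IH|n IH]; first by rewrite mul0r.
    by rewrite intS mulrDl mul1r addrC; exact: shift.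
  by rewrite intS opprD mulrDl mulN1r addrC; exact: shift.
have [u [v uv]] : exists u v : int, u * t + v * p%:Z = 1.
  have ptp : coprimez t p%:Z.
    rewrite /coprimez gcdzC -[_ == _]/(coprime p `|t|) prime_coprime //.
    by apply/negP => pt; apply: nl; apply/multiplesE.
  by have [u [v uv]] := Bezoutz t p%:Z; exists u, v; rewrite uv; apply/eqP.
rewrite -[r]mulr1; apply: (multiple); rewrite -uv.
by apply: shift; apply: (multiple).
Qed.

End RootSpaces.

(* Hilbert's hotel along the sequence g. *)
Lemma set_bij_adjoin (T U : Type) (A : set T) (B : set U) (f : T -> U) (b : U)
    (g : nat -> T) : injective g -> (forall n, A (g n)) ->
  set_bij A B f -> ~ B b -> exists f', set_bij A (b |` B) f'.
Proof.
move=> ginj Ag [fAB finj fsurj] Bb.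
have /choice[f' f'P] : forall x, exists y,
    [/\ x = g 0%N -> y = b, forall n, x = g n.+1 -> y = f (g n) &
        (forall n, x <> g n) -> y = f x].
  move=> x; have [[[|n] ->]|nx] := pselect (exists n, x = g n).
  - by exists b; split=> // [n /ginj|/(_ 0%N)].
  - exists (f (g n)); split=> [/ginj//|m /ginj[->]//|/(_ n.+1)//].
  - by exists (f x); split=> // [x0|n xn]; case: nx; [exists 0%N | exists n.+1].
have f'0 : f' (g 0%N) = b by case: (f'P (g 0%N)) => + _ _; exact.
have f'S n : f' (g n.+1) = f (g n) by case: (f'P (g n.+1)) => _ + _; exact.
have f'N x : (forall n, x <> g n) -> f' x = f x by case: (f'P x) => _ _.
have cases x : (exists n, x = g n) \/ (forall n, x <> g n).
  have [|nx] := pselect (exists n, x = g n); [by left | right=> n xn].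
  by apply: nx; exists n.
have fB x : A x -> f x <> b by move=> /fAB Bfx fb; apply: Bb; rewrite -fb.
have finj' x y : A x -> A y -> f x = f y -> x = y.
  by move=> Ax Ay; apply: finj; rewrite inE.
exists f'; split.
- move=> x Ax; have [[[|n] ->]|nx] := cases x.
  + by rewrite f'0; left.
  + by rewrite f'S; right; exact: fAB.
  + by rewrite f'N //; right; exact: fAB.
- move=> x y; rewrite !inE => Ax Ay.
  have [[[|n] xE]|nx] := cases x; have [[[|m] yE]|ny] := cases y;
    rewrite ?xE ?yE ?f'0 ?f'S ?f'N //.
  + by move=> /esym/(fB _ (Ag _)).
  + by move=> /esym/(fB _ Ay).
  + by move=> /(fB _ (Ag _)).
  + by move=> /(finj' _ _ (Ag _) (Ag _))/ginj->.
  + by move=> /(finj' _ _ (Ag _) Ay) /esym/ny.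
  + by move=> /(fB _ Ax).
  + by move=> /(finj' _ _ Ax (Ag _))/nx.
  + exact: finj'.
- move=> y [->|/fsurj[x Ax <-]]; first by exists (g 0%N).
  have [[n ->]|nx] := cases x; first by exists (g n.+1).
  by exists x; rewrite ?f'N.
Qed.

Lemma prime_sequence : exists2 p : nat -> nat, injective p & forall n, prime (p n).
Proof.
pose next m := s2val (prime_above m).
have next_gt m : (m < next m)%N by rewrite /next; case: (prime_above m).
have next_prime m : prime (next m) by rewrite /next; case: (prime_above m).
(* The index is [n.+1] because the starting value 0 is not prime. *)
exists (fun n => iter n.+1 next 0%N) => [|n]; last exact: next_prime.
have homo : {homo (fun n => iter n.+1 next 0%N) : m n / (m < n)%N}.
  by apply: homo_ltn => [|k]; [exact: ltn_trans | exact: next_gt].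
move=> m n E; have [mn|mn|//] := ltngtP m n;
  by have := homo _ _ mn; rewrite -E ltnn.
Qed.

Theorem mainTheorem5 (R : realType) (L : finLieAlgType R[i]) (H : {vspace L})
    (kappa : invariant_form L) :
  is_simple_lie L -> is_cartan_subalgebra H ->
  exists Phi : set (affine_dual H) -> set (affine_algebra kappa),
    set_bij
      [set Psi | maximal_real_closed_subroot_system kappa Psi]
      [set S | maximal_symmetric_regular_subalgebra
                 (affine_cartan_incl kappa H) S /\
               S <> derived_algebra (affine_algebra kappa)]
      Phi /\
    ((1 < \dim H)%N ->
     forall Psi, maximal_real_closed_subroot_system kappa Psi ->
       roots_of (affine_cartan_incl kappa H) (Phi Psi) `&` real_roots H
       = Psi).
Proof.
move=> simpleL cartanH.
pose f  := @regular_of _ _ kappa H.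
set A := [set Psi | _]; set B := [set S | _ /\ _].
have SC Psi : A Psi -> symmetric_closed Psi.
  by case=> RC _ _; exact: real_closed_symmetric simpleL cartanH _ RC.
have fK Psi : A Psi -> real_part (f Psi) = Psi.
  by move=> /SC; exact: regular_of_real_part.
(* Onto the subalgebras with a real root, [f] is already bijective, with inverse [real_part]. *)
have fbij : set_bij A [set S | B S /\ real_part (H := H) S !=set0] f.
  split.
  - move=> Psi APsi; split; first exact: regular_of_maximal.
    by rewrite fK //; case: APsi => -[].
  - by move=> Psi Psi'; rewrite !inE => APsi APsi' E; rewrite -(fK _ APsi) E fK.
  - move=> S [[maxS nder] ne]; exists (real_part S).
      exact: maximal_real_part.
    by have [_] := maximal_eq_regular_of simpleL cartanH maxS nder.
have [allne|] := pselect (forall S, B S -> real_part (H := H) S !=set0).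
  exists f; split; last by move=> _ Psi; exact: fK.
  suff -> : B = [set S | B S /\ real_part (H := H) S !=set0] by [].
  by apply/seteqP; split=> S // => [BS|[]//]; split=> //; exact: allne.
move=> /existsNP[S0 /not_implyP[BS0 S0e]].
(* A subalgebra [S0] without real roots forces rank one, which makes the second claim vacuous and
   leaves [Phi] free to differ from [f]. *)
have rk : ~ (1 < \dim H)%N.
  move=> rk; apply: S0e; case: BS0 => maxS nder.
  exact: maximal_real_part_nonempty nder.
have [p pinj pp] := prime_sequence.
have := @set_bij_adjoin _ _ A _ f S0 (fun n => multiples (H := H) (p n)) _ _ fbij.
case=> [m n /(multiples_inj simpleL cartanH)/pinj//|n||Phi Phibij].
- exact: multiples_maximal.
- by case.
exists Phi; split; last by move=> /rk.
suff -> : B = S0 |` [set S | B S /\ real_part (H := H) S !=set0] by [].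
apply/seteqP; split=> [S BS|S [->//|[]//]].
have [ne|e] := pselect (real_part (H := H) S !=set0); [by right | left].
(* Every member of [B] without real roots is [regular_of set0], so [S0] is the only point to
   adjoin. *)
have empty S' : B S' -> ~ (real_part (H := H) S' !=set0) -> S' = @regular_of _ _ kappa H set0.
  move=> [maxS nder] /set0P/negP/negPn/eqP e'.
  by have [_] := maximal_eq_regular_of simpleL cartanH maxS nder; rewrite e'.
by rewrite (empty _ BS e) (empty _ BS0 S0e).
Qed.
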